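(* Let $x\in\Omega_{\rm Fr}\cap\Omega_{\rm op}$ and let $A_x\phi=\Lambda\phi$ be a real eigenpair with $\|\phi\|_{L^2(M_x)}=1$ and $\Lambda>0$, where all objects are as defined in the context. Then $\phi^2$ belongs to $H_0^1(D)$ and satisfies $$L_0(\phi^2)=2\Lambda\phi^2M_x-2\Gamma_{\mathcal E}(\phi)\,\mathcal L^2\qquad\text{in }\mathcal D'(D).$$ Equivalently, for every $\zeta\in C_c^\infty(D)$, $$\mathcal E(\phi^2,\zeta)=2\Lambda\int_D\zeta\phi^2\,dM_x-2\int_D\zeta\,\Gamma_{\mathcal E}(\phi)\,dz.$$
   Context: $D\subset\mathbb R^2$ is bounded, open, connected; $0<\gamma<2$; $\mathcal L^2$ is planar Lebesgue measure. $\mathcal E(u,v)=\frac1{2\pi}\int_D\nabla u\cdot\nabla v\,dz$ on $H_0^1(D)$. $L_0=-(2\pi)^{-1}\Delta_D$ (Dirichlet) has eigenvalues $0<\lambda_1\le\lambda_2\le\cdots$ with a real $L^2(D)$-orthonormal eigenbasis $(\varphi_k)$; on $H_0^1(D)$, $L_0u$ is the distribution $\langle L_0u,\zeta\rangle=\mathcal E(u,\zeta)$, $\zeta\in C_c^\infty(D)$. $\Gamma_{\mathcal E}(u)=\frac1{2\pi}|\nabla u|^2$. $\widetilde u$ is a quasi-continuous version of $u\in H_0^1(D)$. $G_D(z,w)\ge0$ is the symmetric Dirichlet Green kernel, $G_D=\int_0^\infty q_t^D\,dt$ with $q^D_t$ the kernel of $e^{-tL_0}$, so $-\Delta_zG_D(z,w)=2\pi\delta_w$.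 Environment space: fix $s_0>0$; $X=H^{-s_0}(D)$ is the Hilbert space of $x=\sum_kx_k\varphi_k$ with $\|x\|^2_{-s_0}=\sum_k(1+\lambda_k)^{-s_0}x_k^2<\infty$; $\mathbb P$ is the law on $X$ of the Gaussian free field $h=\sum_k\xi_k\lambda_k^{-1/2}\varphi_k$ ($\xi_k$ i.i.d. $N(0,1)$), with $h(x)=x$. Chaos: $Q_\varepsilon x(z)=\sum_ke^{-2\pi\varepsilon\lambda_k}x_k\varphi_k(z)$ and $M_{x,\varepsilon}(dz)=\exp(\gamma Q_\varepsilon x(z)-\frac{\gamma^2}2\mathbb E[(Q_\varepsilon h(z))^2])dz$. Let $d_{\rm w}$ be a complete metric for the narrow topology on finite positive Radon measures on $D$; $M_{h,\varepsilon}$ converges in probability as $\varepsilon\downarrow0$, and $\varepsilon_j\downarrow0$ is a fixed deterministic sequence with $\mathbb P(d_{\rm w}(M_{h,\varepsilon_{j+1}},M_{h,\varepsilon_j})>2^{-j})\le2^{-j}$. $\Omega_{\rm GMC}$ is the full-probability Borel set of $x$ for which $(M_{x,\varepsilon_j})_j$ is $d_{\rm w}$-Cauchy; $M_x:=\lim_jM_{x,\varepsilon_j}$ on $\Omega_{\rm GMC}$ and $M_x:=0$ otherwise. Events: $\Omega_{\rm tr}\subset\Omega_{\rm GMC}$ is a fixed full-probability Borel set such that for every $x\in\Omega_{\rm tr}$: $M_x$ is finite, $M_x(A)=0$ for every Borel $A\subset D$ of zero capacity, any $u\in H_0^1(D)$ with $\widetilde u=0$ $M_x$-a.e. vanishes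 quasi-everywhere, and $\mathcal E$ on $V_x=\{u\in H_0^1(D):\widetilde u\in L^2(M_x)\}$ is a closed densely defined form on $L^2(M_x)$, with associated non-negative self-adjoint operator $A_x$. $\Omega_{\rm op}=\Omega_{\rm tr}\cap\{x:\iint G_D(z,w)^2M_x(dz)M_x(dw)<\infty\}$. $\Omega_{\rm Fr}=\Omega_{\rm GMC}\cap\{x:\sup_{n\ge0}2^{n\alpha}\max_QM_x(Q\cap D)<\infty\}$, where the maximum is over the squares $Q=2^{-n}(k+[0,1)^2)$, $k\in\mathbb Z^2$, meeting $D$, and $\alpha>0$ is a fixed exponent depending only on $\gamma$: pick $p\in(1,4/\gamma^2)$ with $\xi=(2+\frac{\gamma^2}2)p-\frac{\gamma^2}2p^2>2$ and $0<\alpha<(\xi-2)/p$. On $\Omega_{\rm Fr}$ one has $M_x(D\cap B(z,r))\le C_xr^\alpha$ for $z\in D$, $0<r\le1$. Eigenfunctions are identified with their bounded continuous representative $z\mapsto\Lambda\int_DG_D(z,w)\phi(w)M_x(dw)$, which equals $\widetilde\phi$ quasi-everywhere. *)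

(* Defs.v *)
From HB Require Import structures.
From mathcomp Require Import all_boot all_order all_algebra finmap.
From mathcomp Require Import all_classical all_reals all_analysis.
Set Implicit Arguments.
Unset Strict Implicit.
Unset Printing Implicit Defensive.
Import Order.TTheory GRing.Theory Num.Theory.
Import numFieldNormedType.Exports.
Local Open Scope classical_set_scope.
Local Open Scope ring_scope.

(* Functions on D are represented by total functions on the plane whose values
   outside D are never used. *)

(* [measurableTypeR R] is R with its Borel sigma-algebra, the type on which
   [lebesgue_measure] lives *)
Definition plane (R : realType) := (measurableTypeR R * measurableTypeR R)%type.

Definition leb2 (R : realType) : {measure set (plane R) -> \bar R} :=
  (@lebesgue_measure R \x @lebesgue_measure R)%E.
Arguments leb2 {R}.

Definition e1 {R : realType} : plane R := (1, 0).
Definition e2 {R : realType} : plane R := (0, 1).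

Definition pick_or (T : Type) (d : T) (P : T -> Prop) : T :=
  if pselect (exists x, P x) is left ex then projT1 (cid ex) else d.

(** * Sobolev space and Dirichlet form *)
Section Sobolev.
Context {R : realType}.
Implicit Types (D : set (plane R)) (u v w f g : plane R -> R).

Fixpoint Ck (n : nat) (f : plane R -> R) : Prop :=
  continuous f /\
  (if n is m.+1 then
     [/\ forall z, derivable f z e1, forall z, derivable f z e2,
         Ck m ('D_e1 f) & Ck m ('D_e2 f)]
   else True).

(* C_c^oo(D) *)
Definition test_fun D (zeta : plane R -> R) : Prop :=
  [/\ forall n, Ck n zeta,
      compact (closure [set z | zeta z <> 0]) &
      closure [set z | zeta z <> 0] `<=` D].

Definition in_L2 (mu : {measure set (plane R) -> \bar R}) D f : Prop :=
  measurable_fun D f /\ (\int[mu]_(z in D) (f z ^+ 2)%:E < +oo)%E.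

Definition L2_cvg (mu : {measure set (plane R) -> \bar R}) D
    (fs : nat -> plane R -> R) f : Prop :=
  (\int[mu]_(z in D) ((fs n z - f z) ^+ 2)%:E)%E @[n --> \oo] --> 0%E.

Definition weak_deriv D (e : plane R) u g : Prop :=
  in_L2 leb2 D g /\
  forall zeta, test_fun D zeta ->
    \int[leb2]_(z in D) (u z * 'D_e zeta z) =
    - \int[leb2]_(z in D) (g z * zeta z).

(* the weak derivative, unique up to a Lebesgue null set when it exists *)
Definition wd D (e : plane R) u : plane R -> R :=
  pick_or (cst 0) (weak_deriv D e u).

Definition H1 D u : Prop :=
  [/\ in_L2 leb2 D u, exists g, weak_deriv D e1 u g
    & exists g, weak_deriv D e2 u g].

(* H_0^1(D): the closure of C_c^oo(D) in H^1(D) *)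
Definition H10 D u : Prop :=
  H1 D u /\
  exists psi : nat -> plane R -> R,
    [/\ forall n, test_fun D (psi n),
        L2_cvg leb2 D psi u,
        L2_cvg leb2 D (fun n => 'D_e1 (psi n)) (wd D e1 u)
      & L2_cvg leb2 D (fun n => 'D_e2 (psi n)) (wd D e2 u)].

Definition grad_dot D u v (z : plane R) : R :=
  wd D e1 u z * wd D e1 v z + wd D e2 u z * wd D e2 v z.

Definition energy D u v : R :=
  (2 * pi)^-1 * \int[leb2]_(z in D) grad_dot D u v z.

Definition Gamma D u (z : plane R) : R := (2 * pi)^-1 * grad_dot D u u z.

(** * Capacity *)

(* 1-capacity of the Dirichlet form (energy, H_0^1(D)) *)
Definition cap_open D (U : set (plane R)) : \bar R :=
  ereal_inf [set (energy D u u + \int[leb2]_(z in D) (u z ^+ 2))%:E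
            | u in [set u | H10 D u /\
                            {ae leb2, forall z, U z -> 1 <= u z}]].

Definition cap D (A : set (plane R)) : \bar R :=
  ereal_inf [set cap_open D U
            | U in [set U | [/\ open U, U `<=` D & A `<=` U]]].

Definition quasi_everywhere D (Pr : plane R -> Prop) : Prop :=
  exists N, [/\ N `<=` D, cap D N = 0%E & forall z, D z -> ~ N z -> Pr z].

Definition quasi_continuous D f : Prop :=
  forall e : R, 0 < e ->
    exists U, [/\ open U, U `<=` D, (cap D U < e%:E)%E
                & {within D `\` U, continuous f}].

(* [ut] is a (Borel) quasi-continuous version of [u] *)
Definition qc_version D u ut : Prop :=
  [/\ measurable_fun D ut, quasi_continuous D ut
    & {ae leb2, forall z, D z -> ut z = u z}].

(** * Spectral data of the Dirichlet operator *)

(* (phi_k) is an L^2(D)-orthonormal basis of eigenfunctions of L_0, numbered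
   from k = 0; as the eigenfunctions are evaluated pointwise below, they are
   the continuous representatives. *)
Definition dirichlet_eigenbasis D (lam : nat -> R)
    (phi : nat -> plane R -> R) : Prop :=
  [/\ 0 < lam 0%N /\ forall k, lam k <= lam k.+1,
      forall k, H10 D (phi k) /\ {within D, continuous (phi k)},
      forall k v, H10 D v ->
        energy D (phi k) v = lam k * \int[leb2]_(z in D) (phi k z * v z),
      forall j k, \int[leb2]_(z in D) (phi j z * phi k z) = (j == k)%:R
    & forall f, in_L2 leb2 D f ->
        L2_cvg leb2 D
          (fun n z => \sum_(k < n)
             (\int[leb2]_(w in D) (f w * phi k w)) * phi k z) f].

(* [q t] is the continuous integral kernel of exp(- t L_0), the latter being
   given by the functional calculus in the eigenbasis. *)
Definition dirichlet_heat_kernel D (lam : nat -> R)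
    (phi : nat -> plane R -> R) (q : R -> plane R -> plane R -> R) : Prop :=
  forall t, 0 < t ->
    {within D `*` D, continuous (fun p : plane R * plane R => q t p.1 p.2)} /\
    forall f, in_L2 leb2 D f ->
      L2_cvg leb2 D
        (fun n z => \sum_(k < n) expR (- (t * lam k)) *
           (\int[leb2]_(w in D) (f w * phi k w)) * phi k z)
        (fun z => \int[leb2]_(w in D) (q t z w * f w)).

Definition green (q : R -> plane R -> plane R -> R) (z w : plane R) : \bar R :=
  (\int[lebesgue_measure]_(t in [set t : R | (0 < t)%R]) (q t z w)%:E)%E.

End Sobolev.

(** * The environment space H^{-s0}(D) and the Gaussian free field *)
Section Environment.
Context {R : realType}.
Variables (lam : nat -> R) (s0 : R).

Definition hneg_terms (x : nat -> R) (k : nat) : R :=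
  (1 + lam k) `^ (- s0) * x k ^+ 2.

(* x = sum_k x_k phi_k is represented by its sequence of coefficients *)
Definition hneg_set : set (nat -> R) :=
  [set x | cvgn (series (hneg_terms x))].

Definition hneg := {x : nat -> R | x \in hneg_set}.

Lemma hneg0 : (fun=> 0) \in hneg_set.
Proof.
rewrite inE /hneg_set /=.
suff -> : series (hneg_terms (fun=> 0)) = cst 0 by exact: is_cvg_cst.
apply/funext => n; rewrite /series /= big1 // => i _.
by rewrite /hneg_terms expr0n mulr0.
Qed.

HB.instance Definition _ := Choice.on hneg.
HB.instance Definition _ := isPointed.Build hneg 
  (exist (fun x => x \in hneg_set) (fun=> 0) hneg0).

Definition hneg_dist (x y : hneg) : R :=
  Num.sqrt (limn (series (hneg_terms (fun k => sval x k - sval y k)))).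

Definition hneg_open : set (set hneg) :=
  [set A | forall x, A x ->
     exists2 r : R, 0 < r & forall y, hneg_dist x y < r -> A y].

(* H^{-s0}(D) with its Borel sigma-algebra *)
Definition env := g_sigma_algebraType hneg_open.

Definition coef (x : env) (k : nat) : R := sval (x : hneg) k.

(* [P] is the law of sum_k xi_k lam_k^{-1/2} phi_k, in canonical form: under
   [P] the variables xi_k(x) = lam_k^{1/2} x_k are i.i.d. N(0,1). *)
Definition xi (k : nat) (x : env) : R := Num.sqrt (lam k) * coef x k.

Definition gff_law (P : probability env R) : Prop :=
  (forall k (B : set R), measurable B ->
     P (xi k @^-1` B) = normal_prob 0 1 B) /\
  (forall (F : {fset nat}) (B : nat -> set R),
     (forall k, measurable (B k)) ->
     P (\bigcap_(k in [set` F]) (xi k @^-1` B k)) =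
     (\prod_(k <- F) P (xi k @^-1` B k))%E).

End Environment.

(** * Finite measures on D with the narrow topology *)
Definition fmeas (R : realType) := {finite_measure set (plane R) -> \bar R}.

Section Narrow.
Context {R : realType}.
Variable D : set (plane R).

(* finite Borel measures on D are the finite Borel measures on the plane that
   do not charge the complement of D (all of them are Radon) *)
Definition carried (mu : fmeas R) : Prop := mu (~` D) = 0%E.

Definition bounded_continuous (f : plane R -> R) : Prop :=
  {within D, continuous f} /\ exists C, forall z, D z -> `|f z| <= C.

Definition narrow_close (n : nat) (f : 'I_n -> plane R -> R) (e : R)
    (mu nu : fmeas R) : Prop :=
  forall i, `|\int[nu]_(z in D) f i z - \int[mu]_(z in D) f i z| < e.

(* [dw] is a complete metric on the finite measures on D whose topology is the
   narrow one: balls and basic narrow neighbourhoods refine each other. *)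
Definition narrow_metric (dw : fmeas R -> fmeas R -> R) : Prop :=
  [/\ forall mu nu, carried mu -> carried nu ->
        [/\ 0 <= dw mu nu, dw mu nu = dw nu mu
          & dw mu nu = 0 <-> forall A, measurable A -> mu A = nu A],
      forall mu nu rho, carried mu -> carried nu -> carried rho ->
        dw mu rho <= dw mu nu + dw nu rho,
      forall mu n (f : 'I_n -> plane R -> R) (e : R), carried mu ->
        (forall i, bounded_continuous (f i)) -> 0 < e ->
        exists2 r : R, 0 < r &
          forall nu, carried nu -> dw mu nu < r -> narrow_close f e mu nu,
      forall mu (r : R), carried mu -> 0 < r ->
        exists n (f : 'I_n -> plane R -> R) (e : R),
          [/\ forall i, bounded_continuous (f i), 0 < e
            & forall nu, carried nu -> narrow_close f e mu nu -> dw mu nu < r]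
    & forall mus : nat -> fmeas R, (forall n, carried (mus n)) ->
        (forall e : R, 0 < e -> exists N, forall m n,
           (N <= m)%N -> (N <= n)%N -> dw (mus m) (mus n) < e) ->
        exists2 mu, carried mu & dw (mus n) mu @[n --> \oo] --> (0 : R)].

End Narrow.

(** * Gaussian multiplicative chaos *)
Section GMC.
Context {R : realType}.
Variables (D : set (plane R)) (gamma s0 : R).
Variables (lam : nat -> R) (phi : nat -> plane R -> R).
Variable P : probability (env lam s0) R.
Variables (dw : fmeas R -> fmeas R -> R) (eps : nat -> R).

Definition Qmoll (e : R) (x : env lam s0) (z : plane R) : R :=
  limn (series (fun k =>
    expR (- (2 * pi * e * lam k)) * coef x k * phi k z)).

Definition gmc_density (e : R) (x : env lam s0) (z : plane R) : R :=
  expR (gamma * Qmoll e x z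
        - gamma ^+ 2 / 2 * fine ('E_P[(fun h => Qmoll e h z ^+ 2)%R])%E).

(* The measure on D with density [gmc_density e x]. *)
Definition gmc_approx (e : R) (x : env lam s0) : fmeas R :=
  pick_or (mzero : fmeas R) (fun mu => forall A, measurable A ->
    mu A = (\int[leb2]_(z in A `&` D) (gmc_density e x z)%:E)%E).

Definition gmc_scales : Prop :=
  [/\ forall j, 0 < eps j, forall j, eps j.+1 <= eps j,
      eps j @[j --> \oo] --> (0 : R)
    & forall j, (P [set x | (2 ^- j <
          dw (gmc_approx (eps j.+1) x) (gmc_approx (eps j) x))%R]
        <= (2 ^- j)%:E)%E].

Definition Omega_GMC : set (env lam s0) :=
  [set x | forall e : R, 0 < e -> exists N, forall i j,
     (N <= i)%N -> (N <= j)%N ->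
     dw (gmc_approx (eps i) x) (gmc_approx (eps j) x) < e].

Definition gmc (x : env lam s0) : fmeas R :=
  if `[< Omega_GMC x >] then
    pick_or (mzero : fmeas R) (fun mu =>
      carried D mu /\
      dw (gmc_approx (eps j) x) mu @[j --> \oo] --> (0 : R))
  else (mzero : fmeas R).

(* the square 2^{-n} ((k1, k2) + [0,1)^2) *)
Definition dyadic (n : nat) (k1 k2 : int) : set (plane R) :=
  [set z | k1%:~R / 2 ^+ n <= z.1 < (k1%:~R + 1) / 2 ^+ n /\
           k2%:~R / 2 ^+ n <= z.2 < (k2%:~R + 1) / 2 ^+ n].

Definition Omega_Fr (alpha : R) : set (env lam s0) :=
  Omega_GMC `&`
  [set x | (ereal_sup [set y | exists n k1 k2,
      (dyadic n k1 k2 `&` D) !=set0 /\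
      y = (2 `^ (n%:R * alpha))%:E * gmc x (dyadic n k1 k2 `&` D)]
    < +oo)%E].

Definition Omega_op (q : R -> plane R -> plane R -> R)
    (Otr : set (env lam s0)) : set (env lam s0) :=
  Otr `&`
  [set x | (\int[gmc x]_(z in D) \int[gmc x]_(w in D) green q z w < +oo)%E].

End GMC.

(** * The trace form on L^2(M) and its operator *)
Section TraceForm.
Context {R : realType}.
Variables (D : set (plane R)) (M : fmeas R).

Definition V_dom (u : plane R -> R) : Prop :=
  H10 D u /\ exists ut, qc_version D u ut /\ in_L2 M D ut.

Definition closed_trace_form : Prop :=
  forall us uts : nat -> plane R -> R,
    (forall n, V_dom (us n) /\ qc_version D (us n) (uts n)) ->
    (forall e : R, 0 < e -> exists N, forall m n, (N <= m)%N -> (N <= n)%N ->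
       energy D (us m \- us n) (us m \- us n)
       + \int[M]_(z in D) ((uts m z - uts n z) ^+ 2) < e) ->
    exists u ut,
      [/\ V_dom u, qc_version D u ut,
          energy D (us n \- u) (us n \- u) @[n --> \oo] --> (0 : R)
        & L2_cvg M D uts ut].

Definition dense_trace_form : Prop :=
  forall f (e : R), in_L2 M D f -> 0 < e ->
    exists u ut, [/\ V_dom u, qc_version D u ut
                   & \int[M]_(z in D) ((f z - ut z) ^+ 2) < e].

(* the defining properties of the points of Omega_tr; finiteness of M is part
   of its type *)
Definition trace_regular : Prop :=
  [/\ forall A, measurable A -> A `<=` D -> cap D A = 0%E -> M A = 0%E,
      forall u ut, H10 D u -> qc_version D u ut ->
        {ae M, forall z, D z -> ut z = 0} ->
        quasi_everywhere D (fun z => ut z = 0),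
      closed_trace_form
    & dense_trace_form].

(* Graph of the operator on L^2(M) associated with the form (energy, V):
   A f = g iff f is the trace of some u in V and energy(u, v) = <g, v>_{L^2(M)}
   for every v in V. *)
Definition trace_op (f g : plane R -> R) : Prop :=
  [/\ in_L2 M D f, in_L2 M D g
    & exists u ut,
      [/\ V_dom u, qc_version D u ut, {ae M, forall z, D z -> ut z = f z}
        & forall v vt, V_dom v -> qc_version D v vt ->
            energy D u v = \int[M]_(z in D) (g z * vt z)]].

(* [phi] is the bounded continuous representative, given by the Green kernel,
   of an eigenfunction of the trace operator with eigenvalue [Lam]. *)
Definition green_representative (q : R -> plane R -> plane R -> R)
    (Lam : R) (phi : plane R -> R) : Prop :=
  [/\ bounded_continuous D phi,
      forall z, D z ->
        (phi z)%:E =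
        (Lam%:E * \int[M]_(w in D) (green q z w * (phi w)%:E))%E
    & forall u ut, H10 D u -> qc_version D u ut ->
        {ae M, forall z, D z -> ut z = phi z} ->
        quasi_everywhere D (fun z => phi z = ut z)].

End TraceForm.

(** * Distributions on D *)
Section Distributions.
Context {R : realType}.
Variable D : set (plane R).

Definition functional := (plane R -> R) -> R.

(* equality in D'(D) *)
Definition distr_eq (S T : functional) : Prop :=
  forall zeta, test_fun D zeta -> S zeta = T zeta.

(* the distribution L_0 u *)
Definition L0 (u : plane R -> R) : functional := energy D u.

(* the distribution f mu *)
Definition distr_of (mu : {measure set (plane R) -> \bar R})
    (f : plane R -> R) : functional :=
  fun zeta => \int[mu]_(z in D) (zeta z * f z).

End Distributions.

(* Main.v *)
(* The integrated eigenvalue equation, tested against [zeta * f], gives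
   [energy f (zeta f) = Lam * \int zeta f^2 dM]; the product rules for [zeta f] and
   [f^2] turn [2 energy f (zeta f)] into
   [energy (f^2) zeta + 2 \int zeta Gamma f dz].
   Test functions are total in L^2(D), because they approximate the eigenbasis, so
   weak derivatives are unique almost everywhere; passing to the limit along test
   functions psi_n -> f shows that the weak gradient of [f^2] is [2 f grad f].
   As [f] is only known to be bounded itself, while the psi_n need not be uniformly
   bounded, [f^2] is approximated in H^1 by [(k sin (psi_n / k))^2], first letting
   n, then k, tend to infinity. *)
Require Import Defs.
From HB Require Import structures.
From mathcomp Require Import all_boot all_order all_algebra finmap.
From mathcomp Require Import all_classical all_reals all_analysis.
From mathcomp Require Import measurable_realfun.
From mathcomp Require Import ring lra.
Set Implicit Arguments.
Unset Strict Implicit.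
Unset Printing Implicit Defensive.
Import Order.TTheory GRing.Theory Num.Theory.
Import numFieldNormedType.Exports.
Local Open Scope classical_set_scope.
Local Open Scope ring_scope.

(** * Smooth functions and test functions *)

Section SmoothFunctions.
Context {R : realType}.
Implicit Types (f g : plane R -> R) (z e : plane R).

(** The weak gradient of [f ^+ 2] and its membership in [H10] raise different difficulties. The
    gradient only needs the Leibniz rule for [psi n * f], one factor being a test function, and then
    limits of pairings that are linear in [psi n]. Membership needs strong L^2 convergence of
    gradients of test functions, where the nonlinearity matters. The sine serves as truncation
    because it is bounded, vanishes at 0, has the identity as its rescaled limit, and keeps
    smoothness of every order: its derivatives involve only sine and cosine. The Lipschitz constant
    of [(k sin (t / k))^2] grows like k, which forces n to go to infinity while k is still fixed. A
    second obstacle is that the eigenvalue equation lives on [L^2(M)], while the product rules hold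
    Lebesgue almost everywhere. Capacity is the bridge: sets of zero capacity are Lebesgue null, so
    the quasi-everywhere identity for [f] also holds almost everywhere in D. Conversely, [zeta * f]
    is continuous in D, hence its own quasi-continuous version and an admissible test vector. *)

Lemma is_derive_line f z e (x l : R) :
  is_derive (x *: e + z) e f l <->
  is_derive x (1 : R) (fun t : R => f (t *: e + z)) l.
Proof.
(* The two difference quotients are the same function of [h]; this gives access to the one-variable
   chain rule here and to the fundamental theorem of calculus on lines later. *)
have E : (fun h : R => h^-1 *: ((f \o shift (x *: e + z)) (h *: e) - f (x *: e + z))) =
  (fun h : R => h^-1 *: (((fun t : R => f (t *: e + z)) \o shift x) (h *: 1)
     - (fun t : R => f (t *: e + z)) x)).
  by apply/funext => h /=; rewrite [h *: 1]mulr1 scalerDl addrA.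
split=> -[df dl]; split.
- by move: df; rewrite /derivable E.
- by move: dl; rewrite /derive E.
- by rewrite /derivable E.
- by rewrite /derive E.
Qed.

Lemma is_derive_sin_comp f z e l :
  is_derive z e f l -> is_derive z e (sin \o f) (cos (f z) * l).
Proof.
have -> : z = (0 : R) *: e + z by rewrite scale0r add0r.
move=> /is_derive_line h; apply/is_derive_line.
exact: (is_derive1_comp (f := sin) (is_derive_sin _) h).
Qed.

Lemma is_derive_cos_comp f z e l :
  is_derive z e f l -> is_derive z e (cos \o f) (- sin (f z) * l).
Proof.
have -> : z = (0 : R) *: e + z by rewrite scale0r add0r.
move=> /is_derive_line h; apply/is_derive_line.
exact: (is_derive1_comp (f := cos) (is_derive_cos _) h).
Qed.

Definition axis e := e = e1 \/ e = e2.

Lemma Ck_continuous n f : Ck n f -> continuous f.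
Proof. by case: n => [|n] []. Qed.

Lemma Ck_derivable n f e z : axis e -> Ck n.+1 f -> derivable f z e.
Proof. by move=> [] -> [_ []]. Qed.

Lemma Ck_derive n f e : axis e -> Ck n.+1 f -> Ck n ('D_e f).
Proof. by move=> [] -> [_ []]. Qed.

Lemma CkS n f : continuous f -> (forall e z, axis e -> derivable f z e) ->
  (forall e, axis e -> Ck n ('D_e f)) -> Ck n.+1 f.
Proof.
by move=> cf df Df; split=> //; split=> [z|z||]; ((apply: df) || (apply: Df));
  (by left) || (by right).
Qed.

Lemma Ck_pred n f : Ck n.+1 f -> Ck n f.
Proof.
elim: n f => [|n IH] f cf; first by split => //; exact: (Ck_continuous cf).
apply: CkS => [|e z ae|e ae]; first exact: Ck_continuous cf.
- exact: Ck_derivable cf.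
- exact/IH/Ck_derive.
Qed.

Lemma Ck_cst n (c : R) : Ck n (cst c : plane R -> R).
Proof.
elim: n c => [|n IH] c.
  by split => // z; exact: cst_continuous.
apply: CkS => [z|e z _|e _]; first exact: cst_continuous.
- exact: derivable_cst.
- by rewrite (_ : 'D_e _ = cst 0) //; apply/funext => z; exact: derive_cst.
Qed.

Lemma CkD n f g : Ck n f -> Ck n g -> Ck n (f + g).
Proof.
elim: n f g => [|n IH] f g cf cg.
  by split => // z; apply: continuousD; [exact: (Ck_continuous cf)|exact: (Ck_continuous cg)].
apply: CkS => [z|e z ae|e ae].
- by apply: continuousD; [exact: (Ck_continuous cf)|exact: (Ck_continuous cg)].
- by apply: derivableD; [exact: Ck_derivable cf|exact: Ck_derivable cg].
- rewrite (_ : 'D_e _ = 'D_e f + 'D_e g); first by apply: IH; exact: Ck_derive.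
  apply/funext => z; rewrite deriveD //.
  + exact: Ck_derivable cf.
  + exact: Ck_derivable cg.
Qed.

Lemma derive_mul n f g e z : axis e -> Ck n.+1 f -> Ck n.+1 g ->
  'D_e (f * g) z = f z * 'D_e g z + g z * 'D_e f z.
Proof.
by move=> ae cf cg; rewrite deriveM //; [exact: Ck_derivable cf|exact: Ck_derivable cg].
Qed.

Lemma CkM n f g : Ck n f -> Ck n g -> Ck n (f * g).
Proof.
elim: n f g => [|n IH] f g cf cg.
  by split => // z; apply: continuousM; [exact: (Ck_continuous cf)|exact: (Ck_continuous cg)].
apply: CkS => [z|e z ae|e ae].
- by apply: continuousM; [exact: (Ck_continuous cf)|exact: (Ck_continuous cg)].
- by apply: derivableM; [exact: Ck_derivable cf|exact: Ck_derivable cg].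
- rewrite (_ : 'D_e _ = f * 'D_e g + g * 'D_e f).
    by apply: CkD; apply: IH; by [exact: Ck_derive|exact: Ck_pred].
  by apply/funext => z; rewrite (@derive_mul n).
Qed.

Lemma derive_sin_comp n f e z : axis e -> Ck n.+1 f ->
  'D_e (sin \o f) z = cos (f z) * 'D_e f z.
Proof.
move=> ae cf; have df := Ck_derivable (z := z) ae cf.
by have [] := is_derive_sin_comp (DeriveDef df erefl).
Qed.

Lemma derive_cos_comp n f e z : axis e -> Ck n.+1 f ->
  'D_e (cos \o f) z = - sin (f z) * 'D_e f z.
Proof.
move=> ae cf; have df := Ck_derivable (z := z) ae cf.
by have [] := is_derive_cos_comp (DeriveDef df erefl).
Qed.

(** The induction has to treat both functions at once, since differentiating either one produces the
    other. *)
Lemma Ck_sin_cos n f : Ck n f -> Ck n (sin \o f) /\ Ck n (cos \o f).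
Proof.
elim: n f => [|n IH] f cf.
  have cf0 := Ck_continuous cf.
  by split; split => // z; apply: continuous_comp; [exact: cf0|exact: continuous_sin
    |exact: cf0|exact: continuous_cos].
have cf0 := Ck_continuous cf.
have [sf' cf'] := IH f (Ck_pred cf).
split; apply: CkS => [z|e z ae|e ae].
- by apply: continuous_comp; [exact: cf0|exact: continuous_sin].
- by have [h _] := is_derive_sin_comp (DeriveDef (Ck_derivable (z := z) ae cf) erefl); exact: h.
- rewrite (_ : 'D_e _ = (cos \o f) * 'D_e f).
    by apply: CkM => //; exact: Ck_derive.
  by apply/funext => z; rewrite (@derive_sin_comp n).
- by apply: continuous_comp; [exact: cf0|exact: continuous_cos].
- by have [h _] := is_derive_cos_comp (DeriveDef (Ck_derivable (z := z) ae cf) erefl); exact: h.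
- rewrite (_ : 'D_e _ = (cst (-1) * (sin \o f)) * 'D_e f).
    by apply: CkM; [apply: CkM => //; exact: Ck_cst|exact: Ck_derive].
  apply/funext => z; rewrite (@derive_cos_comp n)//.
  by rewrite -[RHS]/(-1 * sin (f z) * 'D_e f z) mulN1r.
Qed.

End SmoothFunctions.

(** * Measurability and finite area in the plane *)

Section PlaneMeasure.
Context {R : realType}.
Implicit Types (f g : plane R -> R) (D A : set (plane R)).

(** The sigma-algebra of the plane is the product one, so an open set is exhibited as the countable
    union of the open rectangles with rational endpoints that it contains. *)
Lemma plane_open_measurable A : open A -> measurable A.
Proof.
move=> oA.
pose rect (s : rat * rat * (rat * rat)) : set (plane R) :=
  `]ratr s.1.1, ratr s.1.2[%classic `*` `]ratr s.2.1, ratr s.2.2[%classic.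
have -> : A = \bigcup_s (if `[< rect s `<=` A >] then rect s else set0).
  apply/seteqP; split => [z Az|z [s _]]; last first.
    by case: asboolP => // + rz; apply.
  move: oA; rewrite openE => /(_ _ Az) /nbhs_ballP[e /= e0 eA].
  have [a] := @rat_in_itvoo R (z.1 - e) z.1 ltac:(by rewrite ltrBlDr ltrDl).
  have [b] := @rat_in_itvoo R z.1 (z.1 + e) ltac:(by rewrite ltrDl).
  have [c] := @rat_in_itvoo R (z.2 - e) z.2 ltac:(by rewrite ltrBlDr ltrDl).
  have [d] := @rat_in_itvoo R z.2 (z.2 + e) ltac:(by rewrite ltrDl).
  rewrite !in_itv/= => /andP[d1 d2] /andP[c1 c2] /andP[b1 b2] /andP[a1 a2].
  exists ((a, b), (c, d)) => //; rewrite asboolT.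
    by split; rewrite /= in_itv/=; apply/andP; split.
  move=> w [/=]; rewrite !in_itv/= => /andP[w1 w2] /andP[w3 w4].
  by apply: eA; split; rewrite /ball/= ltr_norml; apply/andP; split; lra.
apply: countable_bigcupT_measurable => // s.
by case: ifP => // _; apply: measurableX => //; exact: measurable_itv.
Qed.

Lemma within_continuous_measurable D f :
  open D -> {within D, continuous f} -> measurable_fun D f.
Proof.
move=> oD; rewrite (continuous_open_subspace f oD) => /(continuous_inP f oD) cf.
apply: (measurability _ (RGenOpens.measurableE R)).
move=> _ [_ [a [b ->] <-]]; apply: plane_open_measurable.
exact/cf/interval_open.
Qed.

Lemma continuous_plane_measurable f : continuous f -> measurable_fun setT f.
Proof.
move=> cf; apply: within_continuous_measurable; first exact: openT.
by rewrite (continuous_open_subspace f openT) => z _; exact: cf.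
Qed.

Lemma bounded_leb2_lty D : measurable D -> bounded_set D -> (leb2 D < +oo)%E.
Proof.
move=> mD [r [_ /(_ (r + 1) ltac:(lra)) hr]].
pose s := `]- (r + 1) - 1, r + 1[%classic : set R.
pose I : set R := `[- (r + 1), r + 1]%classic.
have DI : D `<=` (I `*` I : set (plane R)).
  move=> z /hr /=; rewrite prod_normE /= ge_max => /andP[].
  by rewrite !ler_norml => /andP[? ?] /andP[? ?]; split; rewrite /I /= in_itv/=; apply/andP.
have mI : measurable I by exact: measurable_itv.
apply: (@le_lt_trans _ _ (leb2 (I `*` I))).
  by apply: le_measure => //; rewrite inE//; exact: measurableX.
have -> : leb2 (I `*` I) = (lebesgue_measure I * lebesgue_measure I)%E.
  exact: product_measure1E.
rewrite lebesgue_measure_itv/=.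
by case: ifP => _; rewrite ?mul0e// -EFinB -EFinM ltry.
Qed.

End PlaneMeasure.

(** * Closure properties of test functions *)

Section TestFunctions.
Context {R : realType}.
Variable D : set (plane R).
Implicit Types (f g zeta : plane R -> R).

Lemma test_fun_of_support zeta f : test_fun D zeta -> (forall n, Ck n f) ->
  (forall z, f z <> 0 -> closure [set z | zeta z <> 0] z) -> test_fun D f.
Proof.
move=> [_ cz zD] cf fz.
have ss : closure [set z | f z <> 0] `<=` closure [set z | zeta z <> 0].
  rewrite [X in _ `<=` X](closure_id _).1; last exact: closed_closure.
  exact: closure_subset.
split=> //; last by move=> z /ss /zD.
by apply: subclosed_compact cz ss; exact: closed_closure.
Qed.

(** Off the closed support, [zeta] vanishes on a whole ball, so its derivative there is that of the
    zero function; differentiation therefore does not enlarge the support. *)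
Lemma test_fun_derive zeta e : axis e -> test_fun D zeta -> test_fun D ('D_e zeta).
Proof.
move=> ae tz; have [cz _ _] := tz.
apply: (test_fun_of_support tz) => [n|z]; first exact: Ck_derive.
apply: contra_notP => nz.
have /nbhs_ballP[r r0 hr] : nbhs z (~` closure [set z | zeta z <> 0]).
  by apply: open_nbhs_nbhs; split => //; apply: closed_openC; exact: closed_closure.
have z0 w : ball z r w -> zeta w = 0.
  by move=> /hr; apply: contra_notP => h; exact: subset_closure.
rewrite -(derive_cst (0 : R) z e); apply: near_eq_derive.
by apply/nbhs_ballP; exists r => // w /z0 ->.
Qed.

Lemma test_fun_mul zeta f : test_fun D zeta -> (forall n, Ck n f) ->
  test_fun D (zeta * f).
Proof.
move=> tz cf; have [cz _ _] := tz.
apply: (test_fun_of_support tz) => [n|z zf]; first by apply: CkM.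
by apply: subset_closure => /= z0; apply: zf; rewrite -[LHS]/(zeta z * f z) z0 mul0r.
Qed.

Lemma test_fun0 zeta z : test_fun D zeta -> ~ D z -> zeta z = 0.
Proof.
by move=> [_ _ zD] nD; apply: contra_notP nD => h; apply/zD/subset_closure.
Qed.

Lemma test_fun_continuous zeta : test_fun D zeta -> continuous zeta.
Proof. by move=> [/(_ 0%N) /Ck_continuous]. Qed.

Lemma test_fun_measurable zeta A : measurable A -> test_fun D zeta -> measurable_fun A zeta.
Proof.
move=> mA /test_fun_continuous cz; apply: measurable_funTS.
exact: continuous_plane_measurable.
Qed.

Lemma test_fun_bounded zeta : test_fun D zeta ->
  exists2 C : R, 0 <= C & forall z, `|zeta z| <= C.
Proof.
move=> tz; have [_ cz _] := tz.
have : compact (zeta @` closure [set z | zeta z <> 0]).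
  apply: continuous_compact cz; apply: continuous_subspaceT.
  exact: test_fun_continuous.
move=> /compact_bounded[r [_ /(_ (`|r| + 1))]] h.
have r1 : r < `|r| + 1 by rewrite (le_lt_trans (ler_norm r))// ltrDl.
have {}h := h r1.
exists (`|r| + 1); first by rewrite addr_ge0.
move=> z; have [->|z0] := eqVneq (zeta z) 0; first by rewrite normr0 addr_ge0.
by apply: h; exists z => //; apply: subset_closure; exact/eqP.
Qed.

End TestFunctions.

(** * Square-integrable functions *)

Section SquareIntegrable.
Context {R : realType}.
Variables (mu : {measure set (plane R) -> \bar R}) (D : set (plane R)).
Hypothesis mD : measurable D.
Implicit Types (f g : plane R -> R).

Local Notation sq h := (\int[mu]_(z in D) (h z ^+ 2)%:E)%E.

Lemma sqr_measurable f : measurable_fun D f ->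
  measurable_fun D (EFin \o (fun z => f z ^+ 2)).
Proof. by move=> mf; apply/measurable_EFinP; exact: measurable_funX. Qed.

Lemma in_L2_sqr_integrable f : in_L2 mu D f ->
  mu.-integrable D (EFin \o (fun z => f z ^+ 2)).
Proof.
move=> [mf lf]; apply/integrableP; split; first exact: sqr_measurable.
rewrite (eq_integral (fun z => (f z ^+ 2)%:E))// => z _ /=.
by rewrite ger0_norm// sqr_ge0.
Qed.

Lemma in_L2_mul_integrable f g : in_L2 mu D f -> in_L2 mu D g ->
  mu.-integrable D (EFin \o (fun z => f z * g z)).
Proof.
move=> Lf Lg.
apply: (le_integrable mD (g := fun z => (f z ^+ 2)%:E + (g z ^+ 2)%:E)%E).
- by apply/measurable_EFinP; apply: measurable_funM; [case: Lf|case: Lg].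
- move=> z _ /=; rewrite lee_fin [leRHS]ger0_norm ?addr_ge0 ?sqr_ge0//.
  rewrite normrM -(real_normK (num_real (f z))) -(real_normK (num_real (g z))).
  have := sqr_ge0 (`|f z| - `|g z|).
  have := normr_ge0 (f z); have := normr_ge0 (g z); nra.
- by apply: (integrableD mD); exact: in_L2_sqr_integrable.
Qed.

(** The majorant [c * (a ^+ 2 + b ^+ 2)] covers sums and differences as well as multiplication by a
    bounded function, where [a] and [b] are taken equal. The same shape recurs below for integrals
    and for convergence. *)
Lemma in_L2_le f a b (c : R) : 0 <= c -> measurable_fun D f ->
  in_L2 mu D a -> in_L2 mu D b ->
  (forall z, D z -> f z ^+ 2 <= c * (a z ^+ 2 + b z ^+ 2)) -> in_L2 mu D f.
Proof.
move=> c0 mf La Lb le; split=> //.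
have ile : mu.-integrable D (EFin \o (fun z => f z ^+ 2)).
  apply: (le_integrable mD (g := fun z => c%:E * ((a z ^+ 2)%:E + (b z ^+ 2)%:E))%E).
  - exact: sqr_measurable.
  - move=> z Dz /=; rewrite lee_fin !ger0_norm ?sqr_ge0//; first exact: le.
    by rewrite mulr_ge0// addr_ge0 ?sqr_ge0.
  - apply: (integrableZl mD); apply: (integrableD mD); exact: in_L2_sqr_integrable.
have /integrableP[_] := ile; rewrite (eq_integral (fun z => (f z ^+ 2)%:E))//.
by move=> z _ /=; rewrite ger0_norm// sqr_ge0.
Qed.

Lemma in_L2D f g : in_L2 mu D f -> in_L2 mu D g ->
  in_L2 mu D (fun z => f z + g z).
Proof.
move=> Lf Lg; apply: (@in_L2_le _ f g 2) => //.
- by apply: measurable_funD; [case: Lf|case: Lg].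
- by move=> z _; have := sqr_ge0 (f z - g z); nra.
Qed.

Lemma in_L2_bM f g (C : R) : measurable_fun D f ->
  (forall z, D z -> `|f z| <= C) -> in_L2 mu D g ->
  in_L2 mu D (fun z => f z * g z).
Proof.
move=> mf fC Lg; apply: (@in_L2_le _ g g (C ^+ 2)) => //.
- exact: sqr_ge0.
- by apply: measurable_funM => //; case: Lg.
- move=> z /fC fz; rewrite exprMn -(real_normK (num_real (f z))).
  have f2 : `|f z| ^+ 2 <= C ^+ 2 by rewrite ler_sqr ?nnegrE// (le_trans _ fz).
  by have := sqr_ge0 (g z); have := sqr_ge0 C; nra.
Qed.

Lemma in_L2B f g : in_L2 mu D f -> in_L2 mu D g ->
  in_L2 mu D (fun z => f z - g z).
Proof.
move=> Lf Lg; apply: (@in_L2_le _ f g 2) => //.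
- by apply: measurable_funB; [case: Lf|case: Lg].
- by move=> z _; have := sqr_ge0 (f z + g z); nra.
Qed.

Lemma in_L2_bounded f (C : R) : (mu D < +oo)%E -> measurable_fun D f ->
  (forall z, D z -> `|f z| <= C) -> in_L2 mu D f.
Proof.
move=> muD mf fC; split=> //.
apply: (@le_lt_trans _ _ (\int[mu]_(z in D) (C ^+ 2)%:E)%E).
  apply: ge0_le_integral => //.
  - by move=> z _; rewrite lee_fin sqr_ge0.
  - exact: sqr_measurable.
  - move=> z /fC fz; rewrite lee_fin -(real_normK (num_real (f z))).
    by rewrite ler_sqr ?nnegrE// (le_trans _ fz).
rewrite integral_cst//; have : mu D \is a fin_num by rewrite ge0_fin_numE.
by case: (mu D) muD => // r _ _; rewrite -EFinM ltry.
Qed.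

Lemma in_L2_ae f g : measurable_fun D g -> {ae mu, forall z, D z -> f z = g z} ->
  in_L2 mu D f -> in_L2 mu D g.
Proof.
move=> mg fg [mf lf]; split => //.
rewrite -(ge0_ae_eq_integral mD (f := fun z => (f z ^+ 2)%:E))//.
- exact: sqr_measurable.
- exact: sqr_measurable.
- by move=> z _; rewrite lee_fin sqr_ge0.
- by move=> z _; rewrite lee_fin sqr_ge0.
- by apply: filterS fg => z + Dz => /(_ Dz) ->.
Qed.

Lemma sqr_int_le (h a b : plane R -> R) (c : R) : 0 <= c ->
  measurable_fun D h -> measurable_fun D a -> measurable_fun D b ->
  (forall z, D z -> h z ^+ 2 <= c * (a z ^+ 2 + b z ^+ 2)) ->
  (sq h <= c%:E * (sq a + sq b))%E.
Proof.
move=> c0 mh ma mb le.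
have p0 (u : plane R -> R) z : D z -> (0 <= (u z ^+ 2)%:E)%E.
  by move=> _; rewrite lee_fin sqr_ge0.
rewrite -(ge0_integralD mu mD (p0 a) (sqr_measurable ma) (p0 b) (sqr_measurable mb)).
have p1 z : D z -> (0 <= (a z ^+ 2)%:E + (b z ^+ 2)%:E)%E.
  by move=> Dz; rewrite adde_ge0// p0.
have mab := emeasurable_funD (sqr_measurable ma) (sqr_measurable mb).
rewrite -(ge0_integralZl_EFin mu mD p1 mab c0).
apply: ge0_le_integral => //.
- exact: p0.
- exact: sqr_measurable.
- exact: measurable_funeM.
Qed.

Lemma sqr_int_cvg0_le (h a b : nat -> plane R -> R) (c : R) : 0 <= c ->
  (forall n, measurable_fun D (h n)) -> (forall n, measurable_fun D (a n)) ->
  (forall n, measurable_fun D (b n)) ->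
  (forall n z, D z -> h n z ^+ 2 <= c * (a n z ^+ 2 + b n z ^+ 2)) ->
  sq (a n) @[n --> \oo] --> 0%E -> sq (b n) @[n --> \oo] --> 0%E ->
  sq (h n) @[n --> \oo] --> 0%E.
Proof.
move=> c0 mh ma mb le a0 b0.
apply: (@squeeze_cvge _ _ _ _ (fun=> 0%E) _ (fun n => c%:E * (sq (a n) + sq (b n)))%E).
- apply: nearW => n; apply/andP; split.
    by apply: integral_ge0 => z _; rewrite lee_fin sqr_ge0.
  exact: (sqr_int_le c0 (mh n) (ma n) (mb n) (le n)).
- exact: cvg_cst.
- rewrite -[X in _ --> X](mule0 c%:E); apply: cvgeZl => //.
  by rewrite -[X in _ --> X](adde0 0%E); exact: cvgeD.
Qed.

Lemma L2_cvg_ae (fs : nat -> plane R -> R) f g :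
  (forall n, measurable_fun D (fs n)) -> measurable_fun D f -> measurable_fun D g ->
  {ae mu, forall z, D z -> f z = g z} -> L2_cvg mu D fs f -> L2_cvg mu D fs g.
Proof.
move=> mfs mf mg fg; rewrite /L2_cvg.
suff -> : (fun n => sq (fun z => fs n z - f z)) = (fun n => sq (fun z => fs n z - g z)).
  by [].
apply/funext => n; apply: ge0_ae_eq_integral => //.
- by apply: sqr_measurable; apply: measurable_funB.
- by apply: sqr_measurable; apply: measurable_funB.
- by move=> z _; rewrite lee_fin sqr_ge0.
- by move=> z _; rewrite lee_fin sqr_ge0.
- by apply: filterS fg => z + Dz => /(_ Dz) ->.
Qed.

(** Strong convergence implies weak convergence; a weighted Young inequality plays the role of
    Cauchy-Schwarz. *)
Lemma L2_cvg_int_mul (fs : nat -> plane R -> R) f g :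
  (forall n, in_L2 mu D (fs n)) -> in_L2 mu D f -> in_L2 mu D g ->
  L2_cvg mu D fs f ->
  \int[mu]_(z in D) (fs n z * g z) @[n --> \oo] --> \int[mu]_(z in D) (f z * g z).
Proof.
move=> Lfs Lf Lg cf; apply/cvgrPdist_le => e e0.
have /fine_cvgP[_ /cvgr0Pnorm_lt cN] := cf.
pose G := \int[mu]_(z in D) (g z ^+ 2).
have G0 : 0 <= G by apply: Rintegral_ge0 => z _; rewrite sqr_ge0.
(* Once the squared L^2 distance is below [d ^+ 2], the two Young terms contribute at most [d] and
   [d * G], and [d * (G + 1) = e]. *)
pose d := e / (G + 1).
have G1 : 0 < G + 1 by rewrite ltr_pwDr.
have d0 : 0 < d by rewrite divr_gt0.
near=> n.
rewrite -RintegralB//; [|exact: in_L2_mul_integrable..].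
have Lfn : in_L2 mu D (fun z => fs n z - f z) by exact: in_L2B.
have /= ig := in_L2_mul_integrable Lfn Lg.
have -> : \int[mu]_(z in D) (f z * g z - fs n z * g z) =
    - \int[mu]_(z in D) ((fs n z - f z) * g z).
  rewrite -mulN1r -RintegralZl//; apply: eq_Rintegral => z _; ring.
rewrite normrN.
apply: (le_trans (le_normr_Rintegral mD ig)).
have i1 := in_L2_sqr_integrable Lfn.
have i2 := in_L2_sqr_integrable Lg.
have i1' : mu.-integrable D (EFin \o (fun z => d^-1 * (fs n z - f z) ^+ 2)).
  by have := integrableZl mD d^-1 i1.
have i2' : mu.-integrable D (EFin \o (fun z => d * g z ^+ 2)).
  by have := integrableZl mD d i2.
apply: (@le_trans _ _ (\int[mu]_(z in D) (d^-1 * (fs n z - f z) ^+ 2 + d * g z ^+ 2))).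
  apply: le_Rintegral => //.
  - by have := integrable_abse ig.
  - by have := integrableD mD i1' i2'.
  - (* AM-GM: [2 |ab| <= a^2 / d + d b^2] *)
    move=> z _; set a := fs n z - f z.
    have h : 0 <= d^-1 * (`|a| - d * `|g z|) ^+ 2.
      by rewrite mulr_ge0 ?sqr_ge0// invr_ge0 ltW.
    have E : d^-1 * (`|a| - d * `|g z|) ^+ 2 =
        d^-1 * `|a| ^+ 2 + d * `|g z| ^+ 2 - 2 * (`|a| * `|g z|).
      by field; rewrite gt_eqF.
    rewrite E !real_normK ?num_real// in h.
    rewrite normrM; have := normr_ge0 a; have := normr_ge0 (g z); nra.
rewrite RintegralD// !RintegralZl//.
have nd : `|\int[mu]_(z in D) (fs n z - f z) ^+ 2| < d ^+ 2.
  by near: n; apply: cN; rewrite exprn_gt0.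
have nd' := le_lt_trans (ler_norm _) nd.
have : d^-1 * \int[mu]_(z in D) (fs n z - f z) ^+ 2 <= d.
  by rewrite mulrC ler_pdivrMr// -expr2 ltW.
have dG : d * (G + 1) = e by rewrite /d mulfVK// gt_eqF.
rewrite -/G; nra.
Unshelve. all: by end_near. Qed.

End SquareIntegrable.

(** * Derivatives of test functions have zero integral *)

Section IntegralOfDerivative.
Context {R : realType}.
Implicit Types (D : set (plane R)) (chi : plane R -> R).

Lemma integral_derive_eq0 (F f : R -> R) (s : R) : 0 < s ->
  (forall x : R, is_derive x (1 : R) F (f x)) -> continuous f ->
  F (- s) = 0 -> F s = 0 -> (forall x, ~ (- s <= x <= s) -> f x = 0) ->
  (\int[lebesgue_measure]_x (f x)%:E)%E = 0%E.
Proof.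
move=> s0 dF cf Fs1 Fs2 f0.
have cF : continuous F.
  move=> x; apply: differentiable_continuous; apply/derivable1_diffP.
  by have [] := dF x.
have -> : (\int[lebesgue_measure]_x (f x)%:E)%E =
    (\int[lebesgue_measure]_(x in `[(- s)%R, s]) (f x)%:E)%E.
  rewrite [RHS]integral_mkcond; apply: eq_integral => x _.
  rewrite patchE; case: ifPn => //; rewrite notin_setE /= in_itv/= => h.
  by rewrite f0// => /h.
rewrite (@continuous_FTC2 _ f F) ?Fs1 ?Fs2 ?subee//.
- by rewrite gtrN.
- exact: continuous_subspaceT.
- split; first by move=> x _; have [] := dF x.
  + exact/cvg_at_right_filter/cF.
  + exact/cvg_at_left_filter/cF.
- by move=> x _; rewrite derive1E; have [] := dF x.
Qed.

(** By Fubini, the integral is taken first along lines of direction [e]; on each of them the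
    fundamental theorem of calculus gives zero, because [chi] vanishes at both ends of a long enough
    segment. Applied to products of test functions, this is integration by parts. *)
Lemma test_fun_integral_derive D chi e : open D -> bounded_set D -> axis e ->
  test_fun D chi -> \int[leb2]_(z in D) ('D_e chi z) = 0.
Proof.
move=> oD bD ae tc.
have mD := plane_open_measurable oD.
have td := test_fun_derive ae tc.
have [C C0 hC] := test_fun_bounded td.
have iD : leb2.-integrable D (EFin \o 'D_e chi).
  apply: measurable_bounded_integrable => //.
  - exact: bounded_leb2_lty.
  - exact: (test_fun_measurable mD td).
  - exists C; split; first exact: num_real.
    by move=> x Cx z _; apply: le_trans (hC z) (ltW Cx).
(* Extension by zero: the derivative vanishes off [D], so the integral over [D] is one over the
   whole plane, to which Fubini applies with no condition on the shape of [D]. *)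
have ED : ((EFin \o 'D_e chi) \_ D) = (EFin \o 'D_e chi).
  apply/funext => z; rewrite patchE; case: ifPn => //; rewrite notin_setE => nD.
  by rewrite /= (test_fun0 td).
have iT : leb2.-integrable setT (EFin \o 'D_e chi).
  by have := (integrable_mkcond _ mD).1 iD; rewrite ED.
rewrite /Rintegral integral_mkcond -/(EFin \o 'D_e chi) ED.
suff -> : (\int[leb2]_z (EFin \o 'D_e chi) z)%E = 0%E by [].
have [r [_ /(_ (`|r| + 1))]] := bD.
have r1 : r < `|r| + 1 by rewrite (le_lt_trans (ler_norm r))// ltrDl.
move=> /(_ r1) hr.
(* [D] lies in the square of half-side [|r| + 1]; the strictly larger [s] puts the endpoints [s] and
   [- s] themselves outside [D]. *)
pose s := `|r| + 2.
have s0 : 0 < s by rewrite /s ltr_wpDl.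
have outside (z : plane R) : s <= `|z.1| \/ s <= `|z.2| -> ~ D z.
  move=> sz /hr /=; rewrite prod_normE /= ge_max => /andP[z1 z2].
  have : `|r| + 1 < s by rewrite ltrD2l ltr1n.
  by case: sz => h1 h2; [have := le_trans h1 z1|have := le_trans h1 z2]; rewrite leNgt h2.
have cc := test_fun_continuous td.
have dc (z : plane R) : derivable chi z e.
  by have [/(_ 1%N) c1 _ _] := tc; exact: Ck_derivable c1.
have ns : `|- s| = s by rewrite normrN gtr0_norm.
have ps : `|s| = s by rewrite gtr0_norm.
have nin (x : R) : ~ (- s <= x <= s) -> s <= `|x|.
  by move=> h; rewrite leNgt; apply/negP; rewrite ltr_norml => /andP[*]; apply: h; lra.
have line_cont (w : plane R) : continuous (fun t : R => 'D_e chi (t *: e + w)).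
  move=> t; apply: (@continuous_comp R (plane R) R (fun t : R => t *: e + w) ('D_e chi)); last exact: cc.
  by apply: cvgD; [exact: scalel_continuous|exact: cvg_cst].
case: ae => ee.
- rewrite -[LHS](@integral21_prod_meas1 _ _ _ _ _ lebesgue_measure lebesgue_measure _ iT).
  apply: integral0_eq => y _; rewrite /fubini_G /=.
  have P (t : R) : (t, y) = t *: e + (0, y) :> plane R.
    by rewrite ee /e1; congr pair; rewrite /= ?addr0 ?add0r ?[_ *: _]mulr1 ?[_ *: _]mulr0 ?add0r ?addr0.
  under eq_integral do rewrite P.
  apply: (@integral_derive_eq0 (fun t => chi (t *: e + (0, y)))
    (fun t => 'D_e chi (t *: e + (0, y))) s) => //.
  + by move=> t; exact/is_derive_line/DeriveDef.
  + by rewrite -P; apply/(test_fun0 tc)/outside; left; rewrite ns.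
  + by rewrite -P; apply/(test_fun0 tc)/outside; left; rewrite ps.
  + by move=> t /nin h; rewrite -P; apply/(test_fun0 td)/outside; left.
- rewrite -[LHS](@integral12_prod_meas1 _ _ _ _ _ lebesgue_measure lebesgue_measure _ iT).
  apply: integral0_eq => y _; rewrite /fubini_F /=.
  have P (t : R) : (y, t) = t *: e + (y, 0) :> plane R.
    by rewrite ee /e2; congr pair; rewrite /= ?addr0 ?add0r ?[_ *: _]mulr1 ?[_ *: _]mulr0 ?add0r ?addr0.
  under eq_integral do rewrite P.
  apply: (@integral_derive_eq0 (fun t => chi (t *: e + (y, 0)))
    (fun t => 'D_e chi (t *: e + (y, 0))) s) => //.
  + by move=> t; exact/is_derive_line/DeriveDef.
  + by rewrite -P; apply/(test_fun0 tc)/outside; right; rewrite ns.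
  + by rewrite -P; apply/(test_fun0 tc)/outside; right; rewrite ps.
  + by move=> t /nin h; rewrite -P; apply/(test_fun0 td)/outside; right.
Qed.

End IntegralOfDerivative.

(** * Weak derivatives and $H_0^1(D)$ *)

Section WeakDerivatives.
Context {R : realType}.
Variable D : set (plane R).
Hypotheses (oD : open D) (bD : bounded_set D).
Implicit Types (e : plane R) (u v g h zeta eta : plane R -> R).

Let mD : measurable D := plane_open_measurable oD.

Lemma test_fun_in_L2 zeta : test_fun D zeta -> in_L2 leb2 D zeta.
Proof.
move=> tz; have [C C0 hC] := test_fun_bounded tz.
apply: (in_L2_bounded mD (bounded_leb2_lty mD bD) (test_fun_measurable mD tz)).
by move=> z _; exact: hC.
Qed.

Lemma in_L2_mul_test zeta u : test_fun D zeta -> in_L2 leb2 D u ->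
  in_L2 leb2 D (fun z => zeta z * u z).
Proof.
move=> tz Lu; have [C C0 hC] := test_fun_bounded tz.
exact: (in_L2_bM mD (test_fun_measurable mD tz) (fun z _ => hC z) Lu).
Qed.

Lemma ae_eq_Rintegral (mu : {measure set (plane R) -> \bar R}) u v :
  measurable_fun D u -> measurable_fun D v ->
  {ae mu, forall z, D z -> u z = v z} ->
  \int[mu]_(z in D) u z = \int[mu]_(z in D) v z.
Proof.
move=> mu_ mv uv; rewrite /Rintegral; congr fine; apply: ae_eq_integral => //.
- exact/measurable_EFinP.
- exact/measurable_EFinP.
- by apply: filterS uv => z + Dz => /(_ Dz) ->.
Qed.

(** Totality is stated as triviality of the orthogonal complement. It is the only consequence of the
    eigenbasis that the Sobolev arguments below take as a hypothesis. *)
Definition test_total := forall g, in_L2 leb2 D g ->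
  (forall zeta, test_fun D zeta -> \int[leb2]_(z in D) (g z * zeta z) = 0) ->
  {ae leb2, forall z, D z -> g z = 0}.

(* Each eigenfunction lies in H_0^1(D), hence is an L^2-limit of test functions. *)
Lemma eigenbasis_test_total lam phi : dirichlet_eigenbasis D lam phi -> test_total.
Proof.
move=> [_ H10phi _ _ total] g Lg g0.
have gphi k : \int[leb2]_(w in D) (g w * phi k w) = 0.
  have [[[Lp _ _] [psi [tpsi cpsi _ _]]] _] := H10phi k.
  have h1 := L2_cvg_int_mul mD (fun n => test_fun_in_L2 (tpsi n)) Lp Lg cpsi.
  have E : (fun n => \int[leb2]_(z in D) (psi n z * g z)) = (fun=> 0 : R).
    apply/funext => n; rewrite -(g0 _ (tpsi n)).
    by apply: eq_Rintegral => z _; rewrite mulrC.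
  rewrite E in h1.
  have := cvg_unique _ h1 (@cvg_cst _ _ _ _ _).
  move=> /(_ (@norm_hausdorff _ _)) <-.
  by apply: eq_Rintegral => z _; rewrite mulrC.
have := total g Lg.
have -> : (fun (n : nat) z =>
    \sum_(k < n) (\int[leb2]_(w in D) (g w * phi k w)) * phi k z) = (fun=> cst 0).
  by apply/funext => n; apply/funext => z; rewrite big1// => i _; rewrite gphi mul0r.
move=> h1; have := cvg_unique _ h1 (@cvg_cst _ _ _ _ _).
move=> /(_ (@ereal_hausdorff _) _ _) g20.
have [mg _] := Lg.
have /(ae_eq_integral_abs leb2 mD (sqr_measurable mg)) : 
    (\int[leb2]_(z in D) `|(EFin \o (fun z => (g z ^+ 2)%R)) z| = 0)%E.
  rewrite [RHS]g20; apply: eq_integral => z _ /=.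
  by rewrite sub0r sqrrN ger0_norm// sqr_ge0.
apply: filterS => z + Dz => /(_ Dz) /= [] /eqP.
by rewrite sqrf_eq0 => /eqP.
Qed.

Lemma wdP e u : (exists g, weak_deriv D e u g) -> weak_deriv D e u (wd D e u).
Proof. by rewrite /wd /pick_or; case: pselect => // ex _; case: cid. Qed.

(** The conclusion is an equality of predicates, not just an equivalence, because [wd] is chosen
    from the predicate: functions that agree almost everywhere thus get literally the same [wd]. *)
Lemma weak_deriv_congr e u v : measurable_fun D u -> measurable_fun D v ->
  {ae leb2, forall z, D z -> u z = v z} -> axis e ->
  weak_deriv D e u = weak_deriv D e v.
Proof.
move=> mu_ mv uv ae.
suff E zeta : test_fun D zeta -> \int[leb2]_(z in D) (u z * 'D_e zeta z) =
    \int[leb2]_(z in D) (v z * 'D_e zeta z).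
  apply/funext => g; apply/propext; split=> -[Lg Eg]; split=> // zeta tz.
  - by rewrite -E// Eg.
  - by rewrite E// Eg.
move=> tz; have mz := test_fun_measurable mD (test_fun_derive ae tz).
apply: ae_eq_Rintegral; [exact: measurable_funM..|].
by apply: filterS uv => z + Dz => /(_ Dz) ->.
Qed.

Lemma H10P u : H10 D u -> in_L2 leb2 D u /\
  (forall e, axis e -> weak_deriv D e u (wd D e u)) /\
  exists psi : nat -> plane R -> R, [/\ forall n, test_fun D (psi n),
    L2_cvg leb2 D psi u &
    forall e, axis e -> L2_cvg leb2 D (fun n => 'D_e (psi n)) (wd D e u)].
Proof.
move=> [[Lu w1 w2] [psi [tpsi c0 c1 c2]]]; split=> //; split.
  by move=> e [] ->; exact: wdP.
by exists psi; split; [exact: tpsi|exact: c0|move=> e [] ->; [exact: c1|exact: c2]].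
Qed.

Lemma H10_congr u v : H10 D u -> measurable_fun D v ->
  {ae leb2, forall z, D z -> u z = v z} ->
  H10 D v /\ forall e, axis e -> wd D e v = wd D e u.
Proof.
move=> Hu mv uv.
have [[Lu w1 w2] [psi [tpsi c0 c1 c2]]] := Hu.
have mu_ : measurable_fun D u by case: Lu.
have E e : axis e -> wd D e v = wd D e u.
  by move=> ae; rewrite /wd (weak_deriv_congr mu_ mv uv ae).
split; last exact: E.
split.
  split; first exact: (in_L2_ae mD mv uv Lu).
  - by rewrite -(weak_deriv_congr mu_ mv uv); [exact: w1|left].
  - by rewrite -(weak_deriv_congr mu_ mv uv); [exact: w2|right].
exists psi; split; first exact: tpsi.
- apply: (L2_cvg_ae mD _ mu_ mv uv c0) => n.
  exact: (test_fun_measurable mD (tpsi n)).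
- by rewrite E; [exact: c1|left].
- by rewrite E; [exact: c2|right].
Qed.

Section Total.
Hypothesis total : test_total.

Lemma weak_deriv_unique e u g h : weak_deriv D e u g -> weak_deriv D e u h ->
  {ae leb2, forall z, D z -> g z = h z}.
Proof.
move=> [Lg Eg] [Lh Eh].
have := total (in_L2B mD Lg Lh).
have gh zeta : test_fun D zeta -> \int[leb2]_(z in D) ((g z - h z) * zeta z) = 0.
  move=> tz; have Lz := test_fun_in_L2 tz.
  under eq_Rintegral do rewrite mulrBl.
  rewrite RintegralB//; [|exact: in_L2_mul_integrable..].
  apply/eqP; rewrite subr_eq0; apply/eqP/oppr_inj.
  by rewrite -Eg// -Eh.
move=> /(_ gh); apply: filterS => z + Dz => /(_ Dz) /eqP.
by rewrite subr_eq0 => /eqP.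
Qed.

Lemma wd_ae e u g : weak_deriv D e u g ->
  {ae leb2, forall z, D z -> g z = wd D e u z}.
Proof. by move=> h; apply: (weak_deriv_unique h); apply: wdP; exists g. Qed.

(** The definition of [H10] compares gradients with the arbitrarily chosen [wd]. Almost everywhere
    uniqueness allows an explicit gradient [gr] in its place. *)
Lemma H10_intro (psi : nat -> plane R -> R) v (gr : plane R -> plane R -> R) :
  in_L2 leb2 D v -> (forall e, axis e -> weak_deriv D e v (gr e)) ->
  (forall n, test_fun D (psi n)) -> L2_cvg leb2 D psi v ->
  (forall e, axis e -> L2_cvg leb2 D (fun n => 'D_e (psi n)) (gr e)) ->
  H10 D v.
Proof.
move=> Lv wv tpsi c0 c1.
have a1 : axis (@e1 R) by left.
have a2 : axis (@e2 R) by right.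
have cw e : axis e -> L2_cvg leb2 D (fun n => 'D_e (psi n)) (wd D e v).
  move=> ae; have [Lg _] := wv e ae.
  have [[mw _] _] : weak_deriv D e v (wd D e v).
    by apply: wdP; exists (gr e); exact: wv.
  apply: (L2_cvg_ae mD _ _ mw (wd_ae (wv e ae)) (c1 e ae)).
  - by move=> n; exact: (test_fun_measurable mD (test_fun_derive ae (tpsi n))).
  - by case: Lg.
split; last first.
  by exists psi; split; [exact: tpsi|exact: c0|exact: cw a1|exact: cw a2].
by split; [exact: Lv|exists (gr e1); exact: wv|exists (gr e2); exact: wv].
Qed.

End Total.

Lemma test_fun_derive_mul zeta eta e z : axis e -> test_fun D zeta ->
  test_fun D eta ->
  'D_e (zeta * eta) z = zeta z * 'D_e eta z + eta z * 'D_e zeta z.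
Proof.
by move=> ae [/(_ 1%N) cz _ _] [/(_ 1%N) ce _ _]; exact: (derive_mul z ae cz ce).
Qed.

Lemma weak_deriv_test zeta e : axis e -> test_fun D zeta ->
  weak_deriv D e zeta ('D_e zeta).
Proof.
move=> ae tz; have tdz := test_fun_derive ae tz.
split; first exact: test_fun_in_L2.
move=> eta te; have tde := test_fun_derive ae te.
have [ce _ _] := te.
have := test_fun_integral_derive oD bD ae (test_fun_mul tz ce).
rewrite (@eq_Rintegral _ _ _ _ _ (fun z => zeta z * 'D_e eta z + 'D_e zeta z * eta z));
  last by move=> z _; rewrite test_fun_derive_mul//; congr (_ + _); exact: mulrC.
rewrite RintegralD//; last 2 first.
- by apply: in_L2_mul_integrable => //; exact: test_fun_in_L2.
- by apply: in_L2_mul_integrable => //; exact: test_fun_in_L2.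
by move=> /eqP; rewrite addr_eq0 => /eqP.
Qed.

(** The weak derivative of [u] is tested against [zeta * eta], again a test function; the classical
    product rule then isolates the term with ['D_e zeta]. *)
Lemma weak_deriv_mul_test u g zeta e : axis e -> in_L2 leb2 D u ->
  weak_deriv D e u g -> test_fun D zeta ->
  weak_deriv D e (fun z => zeta z * u z) (fun z => zeta z * g z + 'D_e zeta z * u z).
Proof.
move=> ae Lu [Lg Eg] tz; have tdz := test_fun_derive ae tz.
split; first by apply: in_L2D => //; exact: in_L2_mul_test.
move=> eta te; have tde := test_fun_derive ae te.
have [ce _ _] := te.
have tze := test_fun_mul tz ce.
have Le := test_fun_in_L2 te.
have i1 : leb2.-integrable D (EFin \o (fun z => u z * 'D_e (zeta * eta) z)).
  by apply: in_L2_mul_integrable => //; apply/test_fun_in_L2/test_fun_derive.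
have i2 : leb2.-integrable D (EFin \o (fun z => ('D_e zeta z * u z) * eta z)).
  by apply: in_L2_mul_integrable => //; exact: in_L2_mul_test.
have i3 : leb2.-integrable D (EFin \o (fun z => (zeta z * g z) * eta z)).
  by apply: in_L2_mul_integrable => //; exact: in_L2_mul_test.
rewrite (@eq_Rintegral _ _ _ _ _
    (fun z => u z * 'D_e (zeta * eta) z - ('D_e zeta z * u z) * eta z));
  last by move=> z _; rewrite test_fun_derive_mul//; ring.
rewrite RintegralB// Eg//.
rewrite [in RHS](@eq_Rintegral _ _ _ _ _
    (fun z => (zeta z * g z) * eta z + ('D_e zeta z * u z) * eta z));
  last by move=> z _; rewrite mulrDl.
rewrite RintegralD// opprD; congr (- _ - _).
by apply: eq_Rintegral => z _; rewrite -[(zeta * eta) z]/(zeta z * eta z); ring.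
Qed.

Lemma L2_cvg_mul_test (psi : nat -> plane R -> R) u zeta :
  (forall n, in_L2 leb2 D (psi n)) -> in_L2 leb2 D u -> test_fun D zeta ->
  L2_cvg leb2 D psi u ->
  L2_cvg leb2 D (fun n z => zeta z * psi n z) (fun z => zeta z * u z).
Proof.
move=> Lpsi Lu tz cu; have [C C0 hC] := test_fun_bounded tz.
have mB n : measurable_fun D (fun z => psi n z - u z).
  by apply: measurable_funB; [case: (Lpsi n)|case: Lu].
have mz := test_fun_measurable mD tz.
apply: (sqr_int_cvg0_le mD (sqr_ge0 C) _ mB mB _ cu cu) => [n|n z _].
- apply: measurable_funB; apply: measurable_funM => //; [by case: (Lpsi n)|by case: Lu].
- rewrite -mulrBr exprMn -(real_normK (num_real (zeta z))).
  have f2 : `|zeta z| ^+ 2 <= C ^+ 2 by rewrite ler_sqr ?nnegrE.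
  by have := sqr_ge0 (psi n z - u z); have := sqr_ge0 C; nra.
Qed.

Lemma L2_cvgD (a b : nat -> plane R -> R) u v :
  (forall n, in_L2 leb2 D (a n)) -> (forall n, in_L2 leb2 D (b n)) ->
  in_L2 leb2 D u -> in_L2 leb2 D v ->
  L2_cvg leb2 D a u -> L2_cvg leb2 D b v ->
  L2_cvg leb2 D (fun n z => a n z + b n z) (fun z => u z + v z).
Proof.
move=> La Lb Lu Lv cu cv.
apply: (@sqr_int_cvg0_le _ _ _ mD _ _ _ 2 _ _ _ _ _ cu cv) => // [n|n|n|n z _].
- by case: (in_L2B mD (in_L2D mD (La n) (Lb n)) (in_L2D mD Lu Lv)).
- by case: (in_L2B mD (La n) Lu).
- by case: (in_L2B mD (Lb n) Lv).
- by have := sqr_ge0 ((a n z - u z) - (b n z - v z)); nra.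
Qed.

(** The products [zeta * psi n] approximate [zeta * u] in H^1, as [zeta] and its derivatives are
    bounded. *)
Lemma H10_mul_test u zeta : test_total -> H10 D u -> test_fun D zeta ->
  H10 D (fun z => zeta z * u z) /\
  forall e, axis e -> {ae leb2, forall z, D z ->
    zeta z * wd D e u z + 'D_e zeta z * u z = wd D e (fun z => zeta z * u z) z}.
Proof.
move=> total /H10P[Lu [wu [psi [tpsi c0 c1]]]] tz.
have ww e : axis e -> weak_deriv D e (fun z => zeta z * u z)
    (fun z => zeta z * wd D e u z + 'D_e zeta z * u z).
  by move=> ae; apply: weak_deriv_mul_test => //; exact: wu.
split; last by move=> e ae; exact: (wd_ae total (ww e ae)).
have cpsi n : forall k, Ck k (psi n) by case: (tpsi n).
have Lpsi n : in_L2 leb2 D (psi n) by exact: test_fun_in_L2.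
apply: (@H10_intro total (fun n => zeta * psi n) _
  (fun e z => zeta z * wd D e u z + 'D_e zeta z * u z)) => //.
- exact: in_L2_mul_test.
- by move=> n; exact: test_fun_mul.
- exact: L2_cvg_mul_test.
- move=> e ae; have tdz := test_fun_derive ae tz.
  have -> : (fun n => 'D_e (zeta * psi n)) =
      (fun n z => zeta z * 'D_e (psi n) z + 'D_e zeta z * psi n z).
    apply/funext => n; apply/funext => z.
    by rewrite test_fun_derive_mul// [psi n z * _]mulrC.
  have Ldpsi n : in_L2 leb2 D ('D_e (psi n)) by apply/test_fun_in_L2/test_fun_derive.
  have [Lw _] := wu e ae.
  apply: L2_cvgD.
  + by move=> n; exact: in_L2_mul_test.
  + by move=> n; exact: in_L2_mul_test.
  + exact: in_L2_mul_test.
  + exact: in_L2_mul_test.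
  + by apply: L2_cvg_mul_test => //; exact: c1.
  + exact: L2_cvg_mul_test.
Qed.

(** Only one of the two factors [f] is approximated, so every term of the integrated Leibniz rule is
    linear in [psi n] and passes to the limit. Boundedness of [f] puts [2 * f * wd D e f] in L^2. *)
Lemma weak_deriv_sqr f (C : R) e : H10 D f -> (forall z, D z -> `|f z| <= C) ->
  axis e -> weak_deriv D e (fun z => f z ^+ 2) (fun z => 2 * f z * wd D e f z).
Proof.
move=> /H10P[Lf [wf [psi [tpsi c0 c1]]]] fC ae.
have mf : measurable_fun D f by case: Lf.
have [Lg _] := wf e ae.
have Lfg : in_L2 leb2 D (fun z => f z * wd D e f z) by exact: (in_L2_bM mD mf fC Lg).
split.
  apply: (@in_L2_bM _ _ _ mD (fun z => 2 * f z) _ (2 * C)) => //.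
    by apply: measurable_funM.
  by move=> z /fC; rewrite normrM ger0_norm//; lra.
move=> eta te; have tde := test_fun_derive ae te.
have Lfe : in_L2 leb2 D (fun z => f z * eta z).
  by apply: (in_L2_bM mD mf fC); exact: test_fun_in_L2.
have Lfde : in_L2 leb2 D (fun z => f z * 'D_e eta z).
  by apply: (in_L2_bM mD mf fC); exact: test_fun_in_L2.
have Lge : in_L2 leb2 D (fun z => eta z * wd D e f z) by exact: in_L2_mul_test.
have Lpsi n : in_L2 leb2 D (psi n) by exact: test_fun_in_L2.
have Ldpsi n : in_L2 leb2 D ('D_e (psi n)) by apply/test_fun_in_L2/test_fun_derive.
have lim1 := L2_cvg_int_mul mD Lpsi Lf Lfde c0.
have lim2 := L2_cvg_int_mul mD Lpsi Lf Lge c0.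
have lim3 := L2_cvg_int_mul mD Ldpsi Lg Lfe (c1 e ae).
(* This is the Leibniz rule for [psi n * f], with [psi n] in the role of the test factor, tested
   against [eta]. *)
have E n : \int[leb2]_(z in D) (psi n z * (f z * 'D_e eta z)) =
    - (\int[leb2]_(z in D) (psi n z * (eta z * wd D e f z))
       + \int[leb2]_(z in D) ('D_e (psi n) z * (f z * eta z))).
  have [_ h] := weak_deriv_mul_test ae Lf (wf e ae) (tpsi n).
  have -> : \int[leb2]_(z in D) (psi n z * (f z * 'D_e eta z)) =
      \int[leb2]_(z in D) (psi n z * f z * 'D_e eta z).
    by apply: eq_Rintegral => z _; rewrite mulrA.
  rewrite h// -RintegralD//; [|exact: in_L2_mul_integrable..].
  by congr (- _); apply: eq_Rintegral => z _; ring.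
have E' : (fun n => \int[leb2]_(z in D) (psi n z * (f z * 'D_e eta z))) =
  (fun n => - (\int[leb2]_(z in D) (psi n z * (eta z * wd D e f z))
       + \int[leb2]_(z in D) ('D_e (psi n) z * (f z * eta z)))).
  by apply/funext.
rewrite E' in lim1.
have lim4 := cvgN (cvgD lim2 lim3).
have := cvg_unique _ lim1 (lim4 _ _); move=> /(_ (@norm_hausdorff _ _)).
have -> : \int[leb2]_(z in D) (f z * (f z * 'D_e eta z)) =
    \int[leb2]_(z in D) (f z ^+ 2 * 'D_e eta z).
  by apply: eq_Rintegral => z _; rewrite mulrA -expr2.
move=> ->; congr (- _); rewrite -RintegralD//; [|exact: in_L2_mul_integrable..].
by apply: eq_Rintegral => z _; ring.
Qed.

End WeakDerivatives.

(** * The square of a bounded function of $H_0^1(D)$ *)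

Section SineApproximation.
Context {R : realType}.
Implicit Types (s t k : R).

Lemma lipschitz_of_derive (f df : R -> R) (L : R) :
  (forall x : R, is_derive x (1 : R) f (df x)) -> (forall x, `|df x| <= L) ->
  forall s t, `|f s - f t| <= L * `|s - t|.
Proof.
move=> dF dL.
have lt a b : a < b -> `|f b - f a| <= L * `|b - a|.
  move=> ab; have cf : {within `[a, b], continuous f}.
    apply: continuous_subspaceT => x; apply: differentiable_continuous.
    by apply/derivable1_diffP; have [] := dF x.
  have [c _ ->] := MVT ab (fun x _ => dF x) cf.
  by rewrite normrM ler_wpM2r.
move=> s t; have [st|ts|->] := ltgtP s t.
- by rewrite distrC (distrC s) lt.
- exact: lt.
- by rewrite !subrr normr0 mulr0.
Qed.

Lemma sin_lipschitz s t : `|sin s - sin t| <= `|s - t|.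
Proof.
rewrite -[leRHS]mul1r; apply: (@lipschitz_of_derive sin cos) => x.
by rewrite ler_norml cos_geN1 cos_le1.
Qed.

Lemma cos_lipschitz s t : `|cos s - cos t| <= `|s - t|.
Proof.
rewrite -[leRHS]mul1r; apply: (@lipschitz_of_derive cos (fun x => - sin x)) => x.
by rewrite normrN ler_norml sin_geN1 sin_le1.
Qed.

(** By the mean value theorem the difference is [(cos c - 1) * t] with c between 0 and t, and the
    cosine is 1-Lipschitz. The quadratic rate is crude, but after rescaling it gives an error of
    order [1 / k]. *)
Lemma sin_sub_id t : `|sin t - t| <= t ^+ 2.
Proof.
have pos (y : R) : 0 < y -> `|sin y - y| <= y ^+ 2.
  move=> y0; have cs : {within `[0, y], continuous (@sin R)}.
    by apply: continuous_subspaceT => x; exact: continuous_sin.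
  have [c] := MVT y0 (fun x _ => is_derive_sin x) cs.
  rewrite in_itv/= sin0 !subr0 => /andP[c0 cy] ->.
  have -> : cos c * y - y = (cos c - cos 0) * y by rewrite cos0; ring.
  rewrite normrM (gtr0_norm y0) expr2 ler_pM2r//.
  by rewrite (le_trans (cos_lipschitz _ _))// subr0 gtr0_norm// ltW.
have [t0|t0|->] := ltgtP t 0.
- have := pos (- t); rewrite oppr_gt0 => /(_ t0).
  by rewrite sinN sqrrN -opprD normrN.
- exact: pos.
- by rewrite sin0 subrr normr0 sqr_ge0.
Qed.

(* [ssin k] is bounded, smooth and vanishes at [0], and tends to the identity as
   [k] tends to infinity. *)
Definition ssin k t := k * sin (k^-1 * t).

Lemma ssin_bound k t : 0 < k -> `|ssin k t| <= k.
Proof.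
move=> k0; rewrite normrM gtr0_norm// -[leRHS]mulr1 ler_pM2l//.
by rewrite ler_norml sin_geN1 sin_le1.
Qed.

Lemma ssin_lipschitz k s t : 0 < k -> `|ssin k s - ssin k t| <= `|s - t|.
Proof.
move=> k0; rewrite -mulrBr normrM gtr0_norm//.
rewrite -ler_pdivlMl// (le_trans (sin_lipschitz _ _))//.
by rewrite -mulrBr normrM gtr0_norm// invr_gt0.
Qed.

Lemma ssin_le k t : 0 < k -> `|ssin k t| <= `|t|.
Proof.
move=> k0; have := ssin_lipschitz t 0 k0.
by rewrite subr0 {2}/ssin mulr0 sin0 mulr0 subr0.
Qed.

Lemma ssin_sub_id k t : 0 < k -> `|ssin k t - t| <= t ^+ 2 / k.
Proof.
move=> k0; have -> : ssin k t - t = k * (sin (k^-1 * t) - k^-1 * t).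
  by rewrite /ssin; field; rewrite gt_eqF.
rewrite normrM gtr0_norm// -ler_pdivlMl// (le_trans (sin_sub_id _))//.
by rewrite le_eqVlt; apply/orP; left; apply/eqP; field; rewrite gt_eqF.
Qed.

Lemma cos_bound t : `|cos t| <= 1.
Proof. by rewrite ler_norml cos_geN1 cos_le1. Qed.

(* the derivative of [ssin k ^+ 2] *)
Definition dssin k t := 2 * ssin k t * cos (k^-1 * t).

Lemma dssin_bound k t : 0 < k -> `|dssin k t| <= 2 * k.
Proof.
move=> k0; rewrite (normrM (2 * ssin k t)) (normrM 2) (ger0_norm (ler0n _ 2)) -mulrA ler_pM2l// -[leRHS]mulr1.
by apply: ler_pM => //; [exact: ssin_bound|exact: cos_bound].
Qed.

(** The constant does not depend on [k]: the bound [k] on [ssin k] is cancelled by the factor [k^-1]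
    in the Lipschitz constant of the rescaled cosine. *)
Lemma dssin_lipschitz k s t : 0 < k -> `|dssin k s - dssin k t| <= 4 * `|s - t|.
Proof.
move=> k0; have -> : dssin k s - dssin k t =
  2 * ((ssin k s - ssin k t) * cos (k^-1 * s)
       + ssin k t * (cos (k^-1 * s) - cos (k^-1 * t))) by rewrite /dssin; ring.
rewrite normrM ger0_norm//.
have h1 : `|(ssin k s - ssin k t) * cos (k^-1 * s)| <= `|s - t|.
  rewrite normrM -[leRHS]mulr1; apply: ler_pM => //; last exact: cos_bound.
  exact: ssin_lipschitz.
have h2 : `|ssin k t * (cos (k^-1 * s) - cos (k^-1 * t))| <= `|s - t|.
  rewrite normrM; apply: (@le_trans _ _ (k * (k^-1 * `|s - t|))); last first.
    by rewrite mulrA divff ?gt_eqF// mul1r.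
  apply: ler_pM => //; first exact: ssin_bound.
  rewrite (le_trans (cos_lipschitz _ _))// -mulrBr normrM gtr0_norm//.
  by rewrite invr_gt0.
have := ler_normD ((ssin k s - ssin k t) * cos (k^-1 * s))
  (ssin k t * (cos (k^-1 * s) - cos (k^-1 * t))).
lra.
Qed.

Lemma ssin_sqr_lipschitz k s t : 0 < k ->
  `|ssin k s ^+ 2 - ssin k t ^+ 2| <= 2 * k * `|s - t|.
Proof.
move=> k0; rewrite subr_sqr normrM mulrC; apply: ler_pM => //; last exact: ssin_lipschitz.
by rewrite (le_trans (ler_normD _ _))// mulr2n mulrDl mul1r lerD// ssin_bound.
Qed.

(** In the factorization of the difference of squares, one factor is at most [C ^+ 2 / k] and the
    other at most [2 * C]. *)
Lemma ssin_sqr_sub k t (C : R) : 0 < k -> `|t| <= C ->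
  `|ssin k t ^+ 2 - t ^+ 2| <= 2 * C ^+ 3 / k.
Proof.
move=> k0 tC; have C0 : 0 <= C by rewrite (le_trans _ tC).
have tt : t ^+ 2 <= C ^+ 2 by rewrite -(real_normK (num_real t)) ler_sqr ?nnegrE.
have h1 : `|ssin k t - t| <= C ^+ 2 / k.
  by rewrite (le_trans (ssin_sub_id _ k0))// ler_pM2r// invr_gt0.
have h2 : `|ssin k t + t| <= 2 * C.
  rewrite (le_trans (ler_normD _ _))//; have := ssin_le t k0; lra.
rewrite subr_sqr normrM.
have -> : 2 * C ^+ 3 / k = (C ^+ 2 / k) * (2 * C) by field; rewrite gt_eqF.
exact: ler_pM.
Qed.

Lemma dssin_sub k t (C : R) : 0 < k -> `|t| <= C ->
  `|dssin k t - 2 * t| <= 4 * C ^+ 2 / k.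
Proof.
move=> k0 tC; have C0 : 0 <= C by rewrite (le_trans _ tC).
have tt : t ^+ 2 <= C ^+ 2 by rewrite -(real_normK (num_real t)) ler_sqr ?nnegrE.
have h1 : `|(ssin k t - t) * cos (k^-1 * t)| <= C ^+ 2 / k.
  rewrite normrM -[leRHS]mulr1; apply: ler_pM => //; last exact: cos_bound.
  by rewrite (le_trans (ssin_sub_id _ k0))// ler_pM2r// invr_gt0.
have h2 : `|t * (cos (k^-1 * t) - cos 0)| <= C ^+ 2 / k.
  rewrite normrM expr2 -mulrA; apply: ler_pM => //.
  rewrite (le_trans (cos_lipschitz _ _))// subr0 normrM gtr0_norm ?invr_gt0//.
  by rewrite mulrC ler_pM2r// invr_gt0.
have -> : dssin k t - 2 * t =
    2 * ((ssin k t - t) * cos (k^-1 * t) + t * (cos (k^-1 * t) - cos 0)).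
  by rewrite /dssin cos0; ring.
rewrite normrM ger0_norm//.
have -> : 4 * C ^+ 2 / k = 2 * (C ^+ 2 / k + C ^+ 2 / k) by ring.
by rewrite ler_pM2l// (le_trans (ler_normD _ _))// lerD.
Qed.

Lemma ssin_continuous k : continuous (ssin k).
Proof.
move=> t; apply: cvgM; first exact: cvg_cst.
apply: (@continuous_comp _ _ _ ( *%R k^-1) sin); last exact: continuous_sin.
exact: mulrl_continuous.
Qed.

Lemma dssin_continuous k : continuous (dssin k).
Proof.
move=> t; apply: cvgM; first by apply: cvgM; [exact: cvg_cst|exact: ssin_continuous].
apply: (@continuous_comp _ _ _ ( *%R k^-1) cos); last exact: continuous_cos.
exact: mulrl_continuous.
Qed.

End SineApproximation.

Section SineTestFunctions.
Context {R : realType}.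
Variable D : set (plane R).
Implicit Types (psi : plane R -> R) (e z : plane R).

Lemma test_fun_ssin_sqr psi (k : R) : test_fun D psi ->
  test_fun D (fun z => ssin k (psi z) ^+ 2).
Proof.
move=> tpsi; have [cpsi _ _] := tpsi.
apply: (test_fun_of_support tpsi) => [n|z sz].
  have cs : Ck n (cst k * (sin \o (cst k^-1 * psi)) : plane R -> R).
    apply: CkM; first exact: Ck_cst.
    have [] // := @Ck_sin_cos R n (cst k^-1 * psi).
    by apply: CkM; [exact: Ck_cst|exact: cpsi].
  exact: (CkM cs cs).
by apply: subset_closure => /= z0; apply: sz; rewrite /ssin z0 mulr0 sin0 mulr0 expr0n.
Qed.

Lemma derive_ssin_sqr psi (k : R) e z : 0 < k -> axis e -> test_fun D psi ->
  'D_e (fun z => ssin k (psi z) ^+ 2) z = dssin k (psi z) * 'D_e psi z.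
Proof.
move=> k0 ae [cpsi _ _].
have cv : Ck 1 (cst k^-1 * psi : plane R -> R).
  by apply: CkM; [exact: Ck_cst|exact: cpsi].
have [csv _] := Ck_sin_cos cv.
have cs : Ck 1 (cst k * (sin \o (cst k^-1 * psi)) : plane R -> R).
  by apply: CkM => //; exact: Ck_cst.
have -> : (fun w => ssin k (psi w) ^+ 2) =
    (cst k * (sin \o (cst k^-1 * psi))) * (cst k * (sin \o (cst k^-1 * psi))) by [].
rewrite (derive_mul _ ae cs cs) (derive_mul _ ae (Ck_cst _ _) csv).
rewrite (derive_sin_comp _ ae cv) (derive_mul _ ae (Ck_cst _ _) (cpsi 1%N)).
rewrite !derive_cst /dssin /ssin /= !mulr0 !addr0.
rewrite -[(_ * psi) z]/(k^-1 * psi z) -[(_ * (_ \o _)) z]/(k * sin (k^-1 * psi z)).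
by field; rewrite gt_eqF.
Qed.

End SineTestFunctions.

(** * Convergence to zero of extended-real sequences *)

Section ErealConvergence.
Context {R : realType}.

Lemma cvge0_near_le (u : nat -> \bar R) (c : R) : 0 < c -> u n @[n --> \oo] --> 0%E ->
  \forall n \near \oo, (u n <= c%:E)%E.
Proof.
move=> c0 /fine_cvgP[fu /cvgr0Pnorm_le cu].
near=> n; have fn : u n \is a fin_num by near: n.
rewrite -(fineK fn) lee_fin (le_trans (ler_norm _))//.
by near: n; exact: cu.
Unshelve. all: by end_near. Qed.

Lemma ge0_cvge0 (u : nat -> \bar R) : (forall n, (0 <= u n)%E) ->
  (forall c : R, 0 < c -> \forall n \near \oo, (u n <= c%:E)%E) ->
  u n @[n --> \oo] --> 0%E.
Proof.
move=> u0 cu; apply/fine_cvgP; split.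
  near=> n; rewrite ge0_fin_numE//; apply: (@le_lt_trans _ _ (1 : R)%:E).
    by near: n; exact: cu.
  exact: ltry.
apply/cvgr0Pnorm_le => c c0; near=> n.
have uc : (u n <= c%:E)%E by near: n; exact: cu.
rewrite /= ger0_norm; last exact: fine_ge0.
have fn : u n \is a fin_num by rewrite ge0_fin_numE// (le_lt_trans uc)// ltry.
by rewrite -lee_fin fineK.
Unshelve. all: by end_near. Qed.

End ErealConvergence.

(** * L^2 limits of Lipschitz compositions times a fixed function *)

Section LipschitzComposition.
Context {R : realType}.
Variables (mu : {measure set (plane R) -> \bar R}) (D : set (plane R)).
Hypothesis mD : measurable D.
Implicit Types (f g : plane R -> R).

Local Notation sq h := (\int[mu]_(z in D) (h z ^+ 2)%:E)%E.

Lemma sq_ge0 (h : plane R -> R) : (0 <= sq h)%E.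
Proof. by apply: integral_ge0 => z _; rewrite lee_fin sqr_ge0. Qed.

Lemma sq_dominated_cvg0 (h : nat -> plane R -> R) g : in_L2 mu D g ->
  (forall n, measurable_fun D (h n)) ->
  (forall n z, D z -> h n z ^+ 2 <= g z ^+ 2) ->
  (forall z, D z -> h n z @[n --> \oo] --> 0) -> sq (h n) @[n --> \oo] --> 0%E.
Proof.
move=> Lg mh hg h0.
have [] := @dominated_convergence _ _ _ mu D mD
  (fun n => EFin \o (fun z => h n z ^+ 2)) (cst 0%E)
  (EFin \o (fun z => g z ^+ 2)).
- by move=> n; exact: sqr_measurable.
- exact: measurable_cst.
- apply: aeW => z Dz; apply/fine_cvgP; split; first exact: nearW.
  by rewrite /= -[X in _ --> X](mul0r 0); under eq_fun do rewrite /= expr2;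
    apply: cvgM; exact: h0.
- exact: in_L2_sqr_integrable.
- by apply: aeW => z n Dz /=; rewrite lee_fin ger0_norm ?sqr_ge0// hg.
- by rewrite integral0.
Qed.

(** Truncation of [t] to the interval from [- m] to [m], applied below to an L^2 function. *)
Definition clamp (m t : R) := Num.max (- m) (Num.min t m).

Lemma clamp_le m t : 0 <= m -> `|clamp m t| <= m.
Proof.
move=> m0; rewrite ler_norml /clamp; apply/andP; split.
  by rewrite le_max lexx.
by rewrite ge_max ge_min lexx orbT andbT; lra.
Qed.

Lemma sub_clamp_le m t : 0 <= m -> (t - clamp m t) ^+ 2 <= t ^+ 2.
Proof.
move=> m0; rewrite /clamp; case: (leP t m) => tm; case: (leP (- m)) => h.
- by rewrite subrr expr0n sqr_ge0.
- have : m * (t + m) <= 0 by rewrite mulr_ge0_le0//; lra.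
  have : m * t <= 0 by rewrite mulr_ge0_le0//; lra.
  lra.
- have : 0 <= m * (t - m) by rewrite mulr_ge0//; lra.
  have : 0 <= m * t by rewrite mulr_ge0//; lra.
  lra.
- have : 0 <= m * t by rewrite mulr_ge0//; lra.
  lra.
Qed.

Lemma clamp_id m t : `|t| <= m -> clamp m t = t.
Proof.
rewrite ler_norml => /andP[h1 h2]; rewrite /clamp min_l// max_r//.
Qed.

(** Since [g] may be unbounded, the Lipschitz bound alone does not control the product. The function
    [g] is split at a level m: against its truncation the product is at most [L * m * |fs n - f|],
    and against the remainder it is at most [2 * B * |g - clamp m g|]. No almost everywhere
    convergent subsequence is required. *)
Lemma sq_lipschitz_comp (b : R -> R) (L B : R) (fs : nat -> plane R -> R) f g :
  continuous b -> (forall s t, `|b s - b t| <= L * `|s - t|) ->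
  (forall t, `|b t| <= B) ->
  (forall n, measurable_fun D (fs n)) -> measurable_fun D f -> in_L2 mu D g ->
  L2_cvg mu D fs f ->
  sq (fun z => (b (fs n z) - b (f z)) * g z) @[n --> \oo] --> 0%E.
Proof.
move=> cb bL bB mfs mf Lg cf.
have [mg _] := Lg.
have mb (u : plane R -> R) : measurable_fun D u -> measurable_fun D (b \o u).
  by move=> mu_; apply: measurableT_comp => //; exact: continuous_measurable_fun.
have B0 : 0 <= B := le_trans (normr_ge0 (b 0)) (bB 0).
apply: ge0_cvge0 => [n|c c0]; first exact: sq_ge0.
pose r m z := (2 * B) * (g z - clamp m%:R (g z)).
have mcl m : measurable_fun D (fun z => clamp m (g z)).
  apply: measurable_maxr; first exact: measurable_cst.
  by apply: measurable_minr => //; exact: measurable_cst.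
have mr m : measurable_fun D (r m).
  by apply: measurable_funM; [exact: measurable_cst|exact: measurable_funB].
(* The quarter comes from [(x + y)^2 <= 2 (x^2 + y^2)]: two errors of size [c / 4] add up to [c]. *)
have c4 : 0 < c / 4 by rewrite divr_gt0.
have rcv : sq (r m) @[m --> \oo] --> 0%E.
  apply: (@sq_dominated_cvg0 _ (fun z => 2 * B * g z)) => //.
  - apply: (@in_L2_bM _ _ _ mD (fun=> 2 * B) g (2 * B)) => //.
    by move=> z _; rewrite ger0_norm// mulr_ge0.
  - move=> m z _; rewrite /r !exprMn ler_wpM2l// ?mulr_ge0 ?sqr_ge0//.
    by apply: sub_clamp_le; exact: ler0n.
  - move=> z _; apply: (@cvg_near_cst _ _ (0 : R)); near=> m.
    rewrite /r clamp_id ?subrr ?mulr0//.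
    by near: m; exact: nbhs_infty_ger.
(* The level [m] is fixed before [n], so that [L * m%:R] is a constant when [n] tends to
   infinity. *)
have [m _ /(_ m (leqnn m)) rm] := cvge0_near_le c4 rcv.
pose a n z := L * m%:R * (fs n z - f z).
have mB n : measurable_fun D (fun z => fs n z - f z) by exact: measurable_funB.
have ma n : measurable_fun D (a n).
  by apply: measurable_funM => //; exact: measurable_cst.
have acv : sq (a n) @[n --> \oo] --> 0%E.
  apply: (sqr_int_cvg0_le mD (sqr_ge0 (L * m%:R)) ma mB mB _ cf cf).
  move=> n z _; rewrite /a exprMn; have := sqr_ge0 (fs n z - f z).
  by have := sqr_ge0 (L * m%:R); nra.
have an := cvge0_near_le c4 acv.
near=> n.
apply: (@le_trans _ _ (2%:E * (sq (a n) + sq (r m)))%E).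
  apply: sqr_int_le => // [|z _].
    apply: measurable_funM => //; apply: measurable_funB; exact: mb.
  set y := b (fs n z) - b (f z); set cl := clamp m%:R (g z).
  have h1 : (y * cl) ^+ 2 <= a n z ^+ 2.
    rewrite -(real_normK (num_real (y * cl))) -(real_normK (num_real (a n z))).
    rewrite ler_sqr ?nnegrE// /a normrM (normrM (L * _)) (normrM L).
    rewrite [leRHS]mulrAC; apply: ler_pM => //.
      rewrite (le_trans (bL _ _))// ler_wpM2r// ler_norm//.
    by rewrite (le_trans (clamp_le _ _))// ger0_norm.
  have h2 : (y * (g z - cl)) ^+ 2 <= r m z ^+ 2.
    rewrite /r !exprMn ler_wpM2r ?sqr_ge0//.
    rewrite -exprMn -(real_normK (num_real y)) ler_sqr ?nnegrE// ?mulr_ge0//.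
    rewrite (le_trans (ler_normB _ _))//.
    by have := bB (fs n z); have := bB (f z); lra.
  have -> : y * g z = y * cl + y * (g z - cl) by ring.
  by have := sqr_ge0 (y * cl - y * (g z - cl)); nra.
have -> : c = 2 * (c / 4 + c / 4) by lra.
rewrite EFinM lee_pmul2l// EFinD leeD//.
by near: n.
Unshelve. all: by end_near. Qed.

End LipschitzComposition.

(** * Squares of bounded functions stay in H_0^1 *)

Section SquareSobolev.
Context {R : realType}.
Variable D : set (plane R).
Hypotheses (oD : open D) (bD : bounded_set D).
Hypothesis total : test_total D.
Implicit Types (e z : plane R) (f : plane R -> R).

Let mD : measurable D := plane_open_measurable oD.

Local Notation sq h := (\int[leb2]_(z in D) (h z ^+ 2)%:E)%E.

Lemma cvg0_le_invS (u : nat -> R) (c : R) :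
  (forall m, `|u m| <= c / m.+1%:R) -> u m @[m --> \oo] --> 0.
Proof.
move=> uc; apply/norm_cvg0P.
apply: (@squeeze_cvgr _ _ _ _ (fun=> 0) (fun m => c * harmonic m)).
- by apply: nearW => m; rewrite normr_ge0/= /harmonic.
- exact: cvg_cst.
- rewrite -[X in _ --> X](mulr0 c); apply: cvgM; first exact: cvg_cst.
  exact: cvg_harmonic.
Qed.

(** The statement is given for each tolerance [c] because the index [n] depends on the truncation
    level [k], which itself depends on [c]; a diagonal sequence is extracted afterwards. *)
Lemma bounded_sqr_approx f (C : R) : H10 D f -> (forall z, D z -> `|f z| <= C) ->
  forall c : R, 0 < c -> exists chi, [/\ test_fun D chi,
    (sq (fun z => chi z - f z ^+ 2) <= c%:E)%E &
    forall e, axis e ->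
      (sq (fun z => 'D_e chi z - 2 * f z * wd D e f z) <= c%:E)%E].
Proof.
move=> /(H10P)[Lf [wf [psi [tpsi c0 c1]]]] fC c cpos.
have mf : measurable_fun D f by case: Lf.
have mg e : axis e -> measurable_fun D (wd D e f) by move=> /wf[[]].
have c4 : 0 < c / 4 by rewrite divr_gt0.
have mcomp (b : R -> R) (u : plane R -> R) : continuous b ->
    measurable_fun D u -> measurable_fun D (fun z => b (u z)).
  move=> cb mu_; rewrite -[X in measurable_fun _ X]/(b \o u).
  by apply: measurableT_comp => //; exact: continuous_measurable_fun.
have msin (k : R) (u : plane R -> R) : measurable_fun D u -> measurable_fun D (fun z => ssin k (u z) ^+ 2).
  by move=> mu_; exact: (measurable_funX 2 (mcomp _ _ (@ssin_continuous _ k) mu_)).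
have mdsin (k : R) (u : plane R -> R) : measurable_fun D u -> measurable_fun D (fun z => dssin k (u z)).
  by move=> mu_; exact: (mcomp _ _ (@dssin_continuous _ k) mu_).
have mf2 : measurable_fun D (fun z => f z ^+ 2) by exact: measurable_funX.
have m2f : measurable_fun D (fun z => 2 * f z).
  by apply: measurable_funM => //; exact: measurable_cst.
(* On the range of [f] the truncation error is at most [2 * C ^+ 3 / (m + 1)]; the constant
   [2 * C ^+ 3] dominates it and is square-integrable because [D] has finite area. *)
have s1 : sq (fun z => ssin m.+1%:R (f z) ^+ 2 - f z ^+ 2) @[m --> \oo] --> 0%E.
  apply: (@sq_dominated_cvg0 _ leb2 D mD _ (fun=> 2 * C ^+ 3)).
  - apply: (@in_L2_bounded _ leb2 D mD _ (`|2 * C ^+ 3|)) => //.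
    exact: bounded_leb2_lty.
  - by move=> m; apply: measurable_funB => //; exact: msin.
  - move=> m z Dz; have k0 : 0 < m.+1%:R :> R by rewrite ltr0n.
    have C0 : 0 <= C by rewrite (le_trans _ (fC z Dz)).
    have C3 : 0 <= 2 * C ^+ 3 by rewrite mulr_ge0// exprn_ge0.
    rewrite -(real_normK (num_real (_ - _))) ler_sqr ?nnegrE//.
    rewrite (le_trans (ssin_sqr_sub k0 (fC z Dz)))// ler_pdivrMr// ler_peMr//.
    by rewrite ler1n.
  - move=> z Dz; apply: (@cvg0_le_invS _ (2 * C ^+ 3)) => m.
    by apply: ssin_sqr_sub; [rewrite ltr0n|exact: fC].
have s2 e : axis e ->
    sq (fun z => (dssin m.+1%:R (f z) - 2 * f z) * wd D e f z) @[m --> \oo] --> 0%E.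
  move=> ae; have [Lg _] := wf e ae.
  apply: (@sq_dominated_cvg0 _ leb2 D mD _ (fun z => 4 * C ^+ 2 * wd D e f z)).
  - apply: (@in_L2_bM _ _ _ mD (fun=> 4 * C ^+ 2) _ `|4 * C ^+ 2|) => //.
  - move=> m; apply: measurable_funM; last exact: mg.
    by apply: measurable_funB => //; exact: mdsin.
  - move=> m z Dz; have k0 : 0 < m.+1%:R :> R by rewrite ltr0n.
    have C3 : 0 <= 4 * C ^+ 2 by rewrite mulr_ge0// sqr_ge0.
    rewrite [leLHS]exprMn [leRHS]exprMn ler_wpM2r ?sqr_ge0//.
    rewrite -(real_normK (num_real (_ - _))) ler_sqr ?nnegrE//.
    rewrite (le_trans (dssin_sub k0 (fC z Dz)))// ler_pdivrMr// ler_peMr//.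
    by rewrite ler1n.
  - move=> z Dz; apply: (@cvg0_le_invS _ (4 * C ^+ 2 * `|wd D e f z|)) => m.
    rewrite normrM mulrAC ler_wpM2r//.
    by apply: dssin_sub; [rewrite ltr0n|exact: fC].
(* One level must serve the values and both partial derivatives; the sum of the three thresholds
   exceeds each of them. *)
have [m [h1 h2]] : exists m : nat,
    (sq (fun z => ssin m.+1%:R (f z) ^+ 2 - f z ^+ 2) <= (c / 4)%:E)%E /\
    forall e, axis e ->
    (sq (fun z => (dssin m.+1%:R (f z) - 2 * f z) * wd D e f z) <= (c / 4)%:E)%E.
  have [N1 _ n1] := cvge0_near_le c4 s1.
  have [N2 _ n2] := cvge0_near_le c4 (s2 e1 (or_introl erefl)).
  have [N3 _ n3] := cvge0_near_le c4 (s2 e2 (or_intror erefl)).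
  exists (N1 + (N2 + N3))%N; split; first by apply: n1; rewrite /= leq_addr.
  move=> e [] ->; [apply: n2|apply: n3] => /=.
    by rewrite addnCA leq_addr.
  by rewrite addnA leq_addl.
(* The level [k] stays fixed from here on, so bounds that depend on [k] are harmless in the limit
   along [psi n]. *)
set k := m.+1%:R in h1 h2.
have k0 : 0 < k by rewrite /k ltr0n.
have mpsi n : measurable_fun D (psi n) by exact: (test_fun_measurable mD (tpsi n)).
have mdpsi n e : axis e -> measurable_fun D ('D_e (psi n)).
  by move=> ae; exact: (test_fun_measurable mD (test_fun_derive ae (tpsi n))).
have s3 : sq (fun z => ssin k (psi n z) ^+ 2 - ssin k (f z) ^+ 2) @[n --> \oo] --> 0%E.
  have mB n : measurable_fun D (fun z => psi n z - f z) by exact: measurable_funB.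
  apply: (sqr_int_cvg0_le mD (sqr_ge0 (2 * k)) _ mB mB _ c0 c0) => [n|n z _].
    by apply: measurable_funB; exact: msin.
  have k20 : 0 <= 2 * k by rewrite mulr_ge0// ltW.
  rewrite -(real_normK (num_real (ssin _ _ ^+ 2 - _))).
  apply: (@le_trans _ _ ((2 * k * `|psi n z - f z|) ^+ 2)).
    by rewrite ler_sqr ?nnegrE ?mulr_ge0//; exact: ssin_sqr_lipschitz.
  rewrite exprMn real_normK ?num_real// ler_wpM2l ?sqr_ge0// lerDl.
  exact: sqr_ge0.
have s4 e : axis e -> sq (fun z => dssin k (psi n z) * 'D_e (psi n) z
    - dssin k (f z) * wd D e f z) @[n --> \oo] --> 0%E.
  move=> ae; have [Lg _] := wf e ae.
  have cl := sq_lipschitz_comp mD (@dssin_continuous _ k)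
    (fun s t => dssin_lipschitz s t k0) (fun t => dssin_bound t k0) mpsi mf Lg c0.
  apply: (sqr_int_cvg0_le mD _ _ _ _ _ (c1 e ae) cl) => [|n|n|n|n z _].
  (* This term fixes the constant of the comparison as [2 + 2 * (2 * k) ^+ 2]: with [x] and [y] as
     below, the summand [dssin k (psi n z) * x] is at most [2 * k * |x|], and squaring a sum of two
     terms costs a factor 2. *)
  - exact: (addr_ge0 (ler0n _ 2) (mulr_ge0 (ler0n _ 2) (sqr_ge0 (2 * k)))).
  - apply: measurable_funB; apply: measurable_funM.
    + exact: mdsin.
    + exact: mdpsi.
    + exact: mdsin.
    + exact: mg.
  - by apply: measurable_funB; [exact: mdpsi|exact: mg].
  - apply: measurable_funM; last exact: mg.
    by apply: measurable_funB; exact: mdsin.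
  - set x := 'D_e (psi n) z - wd D e f z.
    set y := (dssin k (psi n z) - dssin k (f z)) * wd D e f z.
    have -> : dssin k (psi n z) * 'D_e (psi n) z - dssin k (f z) * wd D e f z =
      dssin k (psi n z) * x + y by rewrite /x /y; ring.
    have h3 : (dssin k (psi n z) * x) ^+ 2 <= (2 * k) ^+ 2 * x ^+ 2.
      rewrite exprMn ler_wpM2r ?sqr_ge0//.
      have k20 : 0 <= 2 * k by rewrite mulr_ge0// ltW.
      rewrite -(real_normK (num_real (dssin _ _))) ler_sqr ?nnegrE//.
      exact: dssin_bound.
    have := sqr_ge0 (dssin k (psi n z) * x - y).
    have := sqr_ge0 x; have := sqr_ge0 y.
    have := mulr_ge0 (sqr_ge0 (2 * k)) (sqr_ge0 y).
    nra.
have [n [h3 h4]] : exists n : nat,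
    (sq (fun z => ssin k (psi n z) ^+ 2 - ssin k (f z) ^+ 2) <= (c / 4)%:E)%E /\
    forall e, axis e -> (sq (fun z => dssin k (psi n z) * 'D_e (psi n) z
      - dssin k (f z) * wd D e f z) <= (c / 4)%:E)%E.
  have [N1 _ n1] := cvge0_near_le c4 s3.
  have [N2 _ n2] := cvge0_near_le c4 (s4 e1 (or_introl erefl)).
  have [N3 _ n3] := cvge0_near_le c4 (s4 e2 (or_intror erefl)).
  exists (N1 + (N2 + N3))%N; split; first by apply: n1; rewrite /= leq_addr.
  move=> e [] ->; [apply: n2|apply: n3] => /=.
    by rewrite addnCA leq_addr.
  by rewrite addnA leq_addl.
have combine (h a b : plane R -> R) : measurable_fun D h -> measurable_fun D a ->
    measurable_fun D b -> (forall z, h z = a z + b z) ->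
    (sq a <= (c / 4)%:E)%E -> (sq b <= (c / 4)%:E)%E -> (sq h <= c%:E)%E.
  move=> mh ma mb hab ha hb.
  apply: (@le_trans _ _ (2%:E * (sq a + sq b))%E).
    apply: sqr_int_le => // z _; rewrite hab.
    by have := sqr_ge0 (a z - b z); nra.
  have -> : c = 2 * (c / 4 + c / 4) by lra.
  by rewrite [leRHS]EFinM lee_pmul2l// EFinD leeD.
exists (fun z => ssin k (psi n z) ^+ 2); split.
- exact: test_fun_ssin_sqr.
- apply: (combine _ _ _ _ _ _ _ h3 h1) => [|||z].
  + by apply: measurable_funB => //; exact: msin.
  + by apply: measurable_funB => //; exact: msin.
  + by apply: measurable_funB => //; exact: msin.
  + by ring.
- move=> e ae; have mge := mg e ae.
  have m1 : measurable_fun D (fun z => dssin k (psi n z) * 'D_e (psi n) z).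
    by apply: measurable_funM; [exact: mdsin|exact: mdpsi].
  have m2 : measurable_fun D (fun z => dssin k (f z) * wd D e f z).
    by apply: measurable_funM => //; exact: mdsin.
  have m3 : measurable_fun D (fun z => 2 * f z * wd D e f z).
    exact: measurable_funM.
  have mchi := test_fun_measurable mD (test_fun_derive ae (test_fun_ssin_sqr k (tpsi n))).
  apply: (combine _ _ _ _ _ _ _ (h4 e ae) (h2 e ae)) => [|||z].
  + exact: measurable_funB.
  + exact: measurable_funB.
  + by apply: measurable_funM => //; apply: measurable_funB => //; exact: mdsin.
  + by rewrite (derive_ssin_sqr _ k0 ae (tpsi n)); ring.
Qed.

Lemma H10_sqr f (C : R) : H10 D f -> (forall z, D z -> `|f z| <= C) ->
  H10 D (fun z => f z ^+ 2) /\
  forall e, axis e -> {ae leb2, forall z, D z ->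
    2 * f z * wd D e f z = wd D e (fun z => f z ^+ 2) z}.
Proof.
move=> Hf fC; have [Lf _] := H10P Hf.
have ww e : axis e -> weak_deriv D e (fun z => f z ^+ 2) (fun z => 2 * f z * wd D e f z).
  by move=> ae; exact: (weak_deriv_sqr oD bD Hf fC ae).
split; last by move=> e ae; exact: (wd_ae oD bD total (ww e ae)).
have inv_gt0 (n : nat) : 0 < n.+1%:R^-1 :> R by rewrite invr_gt0 ltr0n.
have [chi hchi] := choice (fun n : nat => bounded_sqr_approx Hf fC (inv_gt0 n)).
have to0 (u : nat -> \bar R) : (forall n, (0 <= u n)%E) ->
    (forall n, (u n <= (n.+1%:R^-1)%:E)%E) -> u n @[n --> \oo] --> 0%E.
  move=> u0 un; apply: (@squeeze_cvge _ _ _ _ (fun=> 0%E) _ (EFin \o harmonic)).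
  - by apply: nearW => n; rewrite u0/= un.
  - exact: cvg_cst.
  - by apply/fine_cvgP; split; [exact: nearW|exact: cvg_harmonic].
apply: (@H10_intro _ D oD bD total chi _ (fun e z => 2 * f z * wd D e f z)).
- have mf : measurable_fun D f by case: Lf.
  apply: (@in_L2_bounded _ leb2 D mD _ (C ^+ 2)).
  + exact: bounded_leb2_lty.
  + exact: measurable_funX.
  + move=> z /fC fz; rewrite normrX ler_sqr ?nnegrE//; exact: le_trans fz.
- exact: ww.
- by move=> n; have [] := hchi n.
- apply: to0 => n; first exact: sq_ge0.
  by have [] := hchi n.
- move=> e ae; apply: to0 => n; first exact: sq_ge0.
  by have [_ _ h] := hchi n; exact: h.
Qed.

End SquareSobolev.

(** * Capacity *)

Section Capacity.
Context {R : realType}.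
Variable D : set (plane R).
Hypotheses (oD : open D) (bD : bounded_set D).
Implicit Types (u v zeta : plane R -> R) (U N : set (plane R)).

Let mD : measurable D := plane_open_measurable oD.

(** The L^2 part of the 1-capacity alone suffices: an admissible [u] is at least 1 almost everywhere
    on [U], so its squared norm is at least the area of [U]. *)
Lemma leb2_le_cap_open U : open U -> U `<=` D -> (leb2 U <= cap_open D U)%E.
Proof.
move=> oU UD; apply: le_ereal_inf_tmp => _ [u [Hu u1] <-].
have [Lu _] := H10P Hu.
have mu_ : measurable_fun D u by case: Lu.
have mU := plane_open_measurable oU.
apply: (@le_trans _ _ (\int[leb2]_(z in D) (u z ^+ 2)%:E)%E).
  apply: (@le_trans _ _ (\int[leb2]_(z in U) (u z ^+ 2)%:E)%E); last first.
    apply: ge0_subset_integral => //; first exact: sqr_measurable.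
    by move=> z _; rewrite lee_fin sqr_ge0.
  have -> : leb2 U = (\int[leb2]_(z in U) (cst 1%E z))%E.
    by rewrite integral_cst// mul1e.
  apply: ae_ge0_le_integral => //.
  - by move=> z _; rewrite lee_fin sqr_ge0.
  - by apply: sqr_measurable; exact: measurable_funS UD mu_.
  - apply: filterS u1 => z + Uz => /(_ Uz) uz /=.
    by rewrite lee_fin expr_ge1// (le_trans _ uz).
have /(integrable_fin_num mD) fu := in_L2_sqr_integrable Lu.
rewrite -(fineK fu) lee_fin lerDr mulr_ge0//.
  by rewrite invr_ge0 mulr_ge0// pi_ge0.
by apply: Rintegral_ge0 => z _; rewrite /grad_dot addr_ge0// -expr2 sqr_ge0.
Qed.

(** Measurability of [N] is not assumed, so [N] is enclosed in a countable intersection of open sets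
    of capacity, hence area, at most [1 / (n + 1)]. *)
Lemma cap0_negligible N : cap D N = 0%E -> leb2.-negligible N.
Proof.
move=> cN.
have ex (n : nat) : exists U : set (plane R), [/\ open U, U `<=` D,
    N `<=` U & (leb2 U <= (n.+1%:R^-1)%:E)%E].
  have : (cap D N < (n.+1%:R^-1)%:E)%E by rewrite cN lte_fin invr_gt0 ltr0n.
  move=> /ereal_inf_lt[_ [U [oU UD NU] <-]] cU; exists U; split=> //.
  by apply: (le_trans (leb2_le_cap_open oU UD)); exact: ltW.
have [U hU] := choice ex.
have mU n : measurable (U n) by have [oU _ _ _] := hU n; exact: plane_open_measurable.
have mI : measurable (\bigcap_n U n) by exact: bigcapT_measurable.
exists (\bigcap_n U n); split=> //.
  apply/eqP; rewrite eq_le measure_ge0 andbT; apply/lee_addgt0Pr => c c0.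
  rewrite add0e; have [n nc] : exists n : nat, n.+1%:R^-1 <= c.
    have /cvgr0Pnorm_le /(_ c c0)[n _ /(_ n (leqnn n))] := @cvg_harmonic R.
    by rewrite /harmonic /= ger0_norm// => h; exists n.
  apply: (@le_trans _ _ (leb2 (U n))).
    by apply: le_measure; rewrite ?inE//; exact: bigcap_inf.
  by have [_ _ _ h] := hU n; apply: (le_trans h); rewrite lee_fin.
by move=> z Nz n _; have [_ _ NU _] := hU n; exact: NU.
Qed.

Lemma quasi_everywhere_ae (Pr : plane R -> Prop) : quasi_everywhere D Pr ->
  {ae leb2, forall z, D z -> Pr z}.
Proof.
move=> [N [_ /cap0_negligible nN h]]; apply: negligibleS nN => z /=.
move=> /not_implyP[Dz nP]; apply: contrapT => nNz; exact/nP/h.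
Qed.

Hypothesis total : test_total D.

Lemma H10_test_fun zeta : test_fun D zeta -> H10 D zeta.
Proof.
move=> tz.
have cst_cvg u : L2_cvg leb2 D (fun=> u) u.
  rewrite /L2_cvg; under eq_fun do under eq_integral do rewrite subrr expr0n.
  by rewrite integral0; exact: cvg_cst.
apply: (@H10_intro _ D oD bD total (fun=> zeta) _ (fun e => 'D_e zeta)) => //.
- exact: test_fun_in_L2.
- by move=> e ae; exact: weak_deriv_test.
Qed.

(** Domination of area by capacity gives nonnegativity, and the zero function is an admissible
    competitor on the empty open set. Its [wd] is a choice, known to vanish only almost everywhere,
    so its energy is computed through an almost everywhere equality. *)
Lemma cap_set0 : cap D set0 = 0%E.
Proof.
apply/eqP; rewrite eq_le; apply/andP; split; last first.
  apply: le_ereal_inf_tmp => _ [U [oU UD _] <-].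
  exact: le_trans (leb2_le_cap_open oU UD).
have t0 : test_fun D (cst 0 : plane R -> R).
  have s0 : [set z : plane R | (cst 0 z : R) <> 0] = set0.
    by apply/seteqP; split => z //=; apply.
  by split; [move=> n; exact: Ck_cst|rewrite s0 closure0; exact: compact0
    |rewrite s0 closure0].
have w0 e : axis e -> {ae leb2, forall z, D z -> wd D e (cst 0) z = 0}.
  move=> ae; have := wd_ae oD bD total (weak_deriv_test oD bD ae t0).
  by apply: filterS => z + Dz => /(_ Dz) <-; exact: derive_cst.
have E : energy D (cst 0) (cst 0) + \int[leb2]_(z in D) ((cst 0 z : R) ^+ 2) = 0.
  have [_ [wt _]] := H10P (H10_test_fun t0).
  have mw e : axis e -> measurable_fun D (wd D e (cst 0)) by move=> /wt[[]].
  have m1 := mw e1 (or_introl erefl).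
  have m2 := mw e2 (or_intror erefl).
  rewrite /energy (@ae_eq_Rintegral _ _ oD _ _ (cst 0)).
  - by rewrite /cst !Rintegral_cst// expr0n /= !mul0r mulr0 addr0.
  - exact: (measurable_funD (measurable_funM m1 m1) (measurable_funM m2 m2)).
  - exact: measurable_cst.
  - apply: filterS2 (w0 e1 (or_introl erefl)) (w0 e2 (or_intror erefl)).
    by move=> z h1 h2 Dz; rewrite /grad_dot h1// h2// !mul0r addr0.
have c0 : (cap_open D set0 <= 0)%E.
  apply: ereal_inf_lbound; exists (cst 0); last by rewrite E.
  by split; [exact: H10_test_fun|exact: aeW].
apply: le_trans c0; apply: ereal_inf_lbound; exists set0 => //.
by split; [exact: open0|exact: sub0set|exact: subset_refl].
Qed.

(** The empty set serves as exceptional set at every tolerance, which is where its zero capacity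
    enters. *)
Lemma continuous_qc_version v : {within D, continuous v} -> qc_version D v v.
Proof.
move=> cv; split; first exact: within_continuous_measurable.
- move=> e e0; exists set0; split; [exact: open0|exact: sub0set| |].
  + by rewrite cap_set0 lte_fin.
  + by rewrite setD0.
- exact: aeW.
Qed.

End Capacity.

(** * The energy of a square against a test function *)

Section ProductRule.
Context {R : realType}.
Variable D : set (plane R).
Hypotheses (oD : open D) (bD : bounded_set D).
Hypothesis total : test_total D.
Implicit Types (f zeta : plane R -> R).

Let mD : measurable D := plane_open_measurable oD.

(** With [a = zeta |grad f|^2] and [b = f grad f . grad zeta], the integrand of the left side is
    [2 b], that of [energy D f (zeta f)] is [a + b], and [a] is the Gamma term up to the factor
    [(2 * pi)^-1]. The identity is [2 b = 2 (a + b) - 2 a]. *)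
Lemma energy_sqr_test f zeta (C : R) : H10 D f -> (forall z, D z -> `|f z| <= C) ->
  test_fun D zeta ->
  energy D (fun z => f z ^+ 2) zeta =
  2 * energy D f (fun z => zeta z * f z)
  - 2 * \int[leb2]_(z in D) (zeta z * Gamma D f z).
Proof.
move=> Hf fC tz; have [Lf [wf _]] := H10P Hf.
have mf : measurable_fun D f by case: Lf.
have Lg e : axis e -> in_L2 leb2 D (wd D e f) by move=> /wf[].
have [Hv wv] := H10_mul_test oD bD total Hf tz.
have [Hs ws] := H10_sqr oD bD total Hf fC.
have wz e : axis e -> {ae leb2, forall z, D z -> 'D_e zeta z = wd D e zeta z}.
  by move=> ae; exact: (wd_ae oD bD total (weak_deriv_test oD bD ae tz)).
have mwd u e : axis e -> H10 D u -> measurable_fun D (wd D e u).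
  by move=> ae /H10P[_ [/(_ e ae)[[]]]].
have mgd u v : H10 D u -> H10 D v -> measurable_fun D (grad_dot D u v).
  move=> Hu Hw; have a1 : axis (@e1 R) by left.
  have a2 : axis (@e2 R) by right.
  exact: (measurable_funD (measurable_funM (mwd _ _ a1 Hu) (mwd _ _ a1 Hw))
                          (measurable_funM (mwd _ _ a2 Hu) (mwd _ _ a2 Hw))).
have a1 : axis (@e1 R) by left.
have a2 : axis (@e2 R) by right.
(* The renaming prevents slow conversion tests between the two coordinates. *)
have [g1 g1E] : exists g, g = wd D e1 f := ex_intro _ _ erefl.
have [g2 g2E] : exists g, g = wd D e2 f := ex_intro _ _ erefl.
have [d1 d1E] : exists d, d = 'D_e1 zeta := ex_intro _ _ erefl.
have [d2 d2E] : exists d, d = 'D_e2 zeta := ex_intro _ _ erefl.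
have Lg1 : in_L2 leb2 D g1 by rewrite g1E; exact: Lg.
have Lg2 : in_L2 leb2 D g2 by rewrite g2E; exact: Lg.
have Ld1 : in_L2 leb2 D (fun z => d1 z * f z).
  by rewrite d1E; apply: in_L2_mul_test => //; exact: test_fun_derive.
have Ld2 : in_L2 leb2 D (fun z => d2 z * f z).
  by rewrite d2E; apply: in_L2_mul_test => //; exact: test_fun_derive.
have Lz1 : in_L2 leb2 D (fun z => zeta z * g1 z) by exact: in_L2_mul_test.
have Lz2 : in_L2 leb2 D (fun z => zeta z * g2 z) by exact: in_L2_mul_test.
have wv1 : {ae leb2, forall z, D z ->
    zeta z * g1 z + d1 z * f z = wd D e1 (fun z => zeta z * f z) z}.
  by rewrite g1E d1E; exact: wv.
have wv2 : {ae leb2, forall z, D z ->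
    zeta z * g2 z + d2 z * f z = wd D e2 (fun z => zeta z * f z) z}.
  by rewrite g2E d2E; exact: wv.
have ws1 : {ae leb2, forall z, D z -> 2 * f z * g1 z = wd D e1 (fun z => f z ^+ 2) z}.
  by rewrite g1E; exact: ws.
have ws2 : {ae leb2, forall z, D z -> 2 * f z * g2 z = wd D e2 (fun z => f z ^+ 2) z}.
  by rewrite g2E; exact: ws.
have wz1 : {ae leb2, forall z, D z -> d1 z = wd D e1 zeta z}.
  by rewrite d1E; exact: wz.
have wz2 : {ae leb2, forall z, D z -> d2 z = wd D e2 zeta z}.
  by rewrite d2E; exact: wz.
have gff z : grad_dot D f f z = g1 z * g1 z + g2 z * g2 z by rewrite g1E g2E.
pose a z := g1 z * (zeta z * g1 z) + g2 z * (zeta z * g2 z).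
pose b z := g1 z * (d1 z * f z) + g2 z * (d2 z * f z).
have ia : leb2.-integrable D (EFin \o a).
  exact: (integrableD mD (in_L2_mul_integrable mD Lg1 Lz1)
                         (in_L2_mul_integrable mD Lg2 Lz2)).
have ib : leb2.-integrable D (EFin \o b).
  exact: (integrableD mD (in_L2_mul_integrable mD Lg1 Ld1)
                         (in_L2_mul_integrable mD Lg2 Ld2)).
have ma : measurable_fun D a by case/integrableP: ia => /measurable_EFinP.
have mb : measurable_fun D b by case/integrableP: ib => /measurable_EFinP.
have E1 : \int[leb2]_(z in D) grad_dot D f (fun z => zeta z * f z) z =
    \int[leb2]_(z in D) a z + \int[leb2]_(z in D) b z.
  rewrite -RintegralD//; apply: ae_eq_Rintegral => //.
  - exact: (mgd _ _ Hf Hv).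
  - exact: measurable_funD.
  - apply: filterS2 wv1 wv2 => z h1 h2 Dz.
    by rewrite /a /b /grad_dot -h1// -h2// -g1E -g2E; ring.
have E2 : \int[leb2]_(z in D) grad_dot D (fun z => f z ^+ 2) zeta z =
    2 * \int[leb2]_(z in D) b z.
  rewrite -RintegralZl//; apply: ae_eq_Rintegral => //.
  - exact: (mgd _ _ Hs (H10_test_fun oD bD total tz)).
  - by apply: measurable_funM => //; exact: measurable_cst.
  - apply: filterS2 (filterI ws1 wz1) (filterI ws2 wz2) => z [h1 h2] [h3 h4] Dz.
    by rewrite /b /grad_dot -h1// -h2// -h3// -h4//; ring.
have E3 : \int[leb2]_(z in D) (zeta z * Gamma D f z) =
    (2 * pi)^-1 * \int[leb2]_(z in D) a z.
  by rewrite -RintegralZl//; apply: eq_Rintegral => z _; rewrite /Gamma gff /a; ring.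
by rewrite /energy E1 E2 E3; ring.
Qed.

End ProductRule.

(** * The square of an eigenfunction of the trace operator *)

Theorem lemma6p29 (R : realType)
  (D : set (plane R)) (gamma s0 : R)
  (lam : nat -> R) (phi : nat -> plane R -> R)
  (q : R -> plane R -> plane R -> R)
  (P : probability (env lam s0) R)
  (dw : fmeas R -> fmeas R -> R) (eps : nat -> R)
  (Otr : set (env lam s0)) (p alpha : R)
  (D_bounded : bounded_set D) (D_open : open D) (D_connected : connected D)
  (gamma_range : 0 < gamma < 2) (s0_gt0 : 0 < s0)
  (basis : dirichlet_eigenbasis D lam phi)
  (heat : dirichlet_heat_kernel D lam phi q)
  (P_gff : gff_law P)
  (dw_narrow : narrow_metric D dw)
  (scales : gmc_scales D gamma phi P dw eps)
  (Otr_measurable : measurable Otr) (Otr_full : P Otr = 1%E)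
  (Otr_GMC : Otr `<=` Omega_GMC D gamma phi P dw eps)
  (Otr_regular : forall x, Otr x ->
     trace_regular D (gmc D gamma phi P dw eps x))
  (p_range : 1 < p < 4 / gamma ^+ 2)
  (xi_gt2 : 2 < (2 + gamma ^+ 2 / 2) * p - gamma ^+ 2 / 2 * p ^+ 2)
  (alpha_range : 0 < alpha <
     ((2 + gamma ^+ 2 / 2) * p - gamma ^+ 2 / 2 * p ^+ 2 - 2) / p)
  (x : env lam s0)
  (x_Fr : Omega_Fr D gamma phi P dw eps alpha x)
  (x_op : Omega_op D gamma phi P dw eps q Otr x)
  (M : fmeas R) (M_def : M = gmc D gamma phi P dw eps x)
  (Lam : R) (f : plane R -> R)
  (Lam_gt0 : 0 < Lam)
  (f_eigen : trace_op D M f (fun z => Lam * f z))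
  (f_rep : green_representative D M q Lam f)
  (f_norm : \int[M]_(z in D) (f z ^+ 2) = 1) :
  let f2 := fun z => f z ^+ 2 in
  [/\ H10 D f2,
      distr_eq D (L0 D f2)
        (fun zeta => 2 * Lam * distr_of D M f2 zeta
                     - 2 * distr_of D leb2 (Gamma D f) zeta)
    & forall zeta, test_fun D zeta ->
        energy D f2 zeta =
        2 * Lam * \int[M]_(z in D) (zeta z * f z ^+ 2)
        - 2 * \int[leb2]_(z in D) (zeta z * Gamma D f z)].
Proof.
have [[fcont [C fC]] _ f_qe] := f_rep.
have [_ _ [u [ut [Vu qcu utf eig]]]] := f_eigen.
have [Hu _] := Vu.
have mD := plane_open_measurable D_open.
have total := eigenbasis_test_total D_open D_bounded basis.
have mf := within_continuous_measurable D_open fcont.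
(* The eigenvalue relation identifies [f] with the trace of [u] only [M]-almost everywhere, which by
   itself says nothing about Lebesgue measure. The quasi-everywhere clause of [f_rep] closes the
   gap, since zero capacity implies zero area. *)
have uf : {ae leb2, forall z, D z -> u z = f z}.
  have fut := quasi_everywhere_ae D_open (f_qe u ut Hu qcu utf).
  have [_ _ utu] := qcu.
  by apply: filterS2 fut utu => z h1 h2 Dz; rewrite h1// h2.
have [Hf wdf] := H10_congr D_open Hu mf uf.
have MD : (M D < +oo)%E by rewrite ltey_eq fin_num_measure.
have LMf : in_L2 M D f by exact: in_L2_bounded fC.
have main zeta : test_fun D zeta -> energy D (fun z => f z ^+ 2) zeta =
    2 * Lam * \int[M]_(z in D) (zeta z * f z ^+ 2)
    - 2 * \int[leb2]_(z in D) (zeta z * Gamma D f z).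
  move=> tz; rewrite (energy_sqr_test D_open D_bounded total Hf fC tz).
  have [K K0 zK] := test_fun_bounded tz.
  have mz := test_fun_measurable mD tz.
  have [Hv _] := H10_mul_test D_open D_bounded total Hf tz.
  have cv : {within D, continuous (fun z => zeta z * f z)}.
    move=> z; apply: continuousM; last exact: fcont.
    exact/continuous_subspaceT/(test_fun_continuous tz).
  (* Continuity of [f] in [D] is what makes [zeta * f] its own version, so the right side of the
     eigenvalue relation is the integral of [Lam * f * (zeta * f)] against [M]. *)
  have qcv := continuous_qc_version D_open D_bounded total cv.
  have LMv : in_L2 M D (fun z => zeta z * f z).
    by apply: (in_L2_bM mD mz _ LMf) => z _; exact: zK.
  have Vv : V_dom D M (fun z => zeta z * f z) by split=> //; exists (fun z => zeta z * f z).
  have := eig _ _ Vv qcv.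
  (* The chosen weak gradients of [u] and [f] are equal as functions, so the two energies coincide
     by rewriting. *)
  have -> : energy D u (fun z => zeta z * f z) = energy D f (fun z => zeta z * f z).
    rewrite /energy /grad_dot wdf; last by left.
    by rewrite wdf//; right.
  move=> ->; congr (_ - _); rewrite -mulrA; congr (2 * _).
  rewrite -RintegralZl//; last first.
    have -> : EFin \o (fun z => zeta z * f z ^+ 2) = EFin \o (fun z => zeta z * f z * f z).
      by apply/funext => z /=; rewrite expr2 mulrA.
    exact: in_L2_mul_integrable.
  by apply: eq_Rintegral => z _; ring.
move=> f2; split.
- by have [] := H10_sqr D_open D_bounded total Hf fC.
- by move=> zeta tz; exact: main.
- exact: main.
Qed.
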